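(* Let $\mathcal{C}=\{C_1,\dots,C_k\}\subset\mathbb{P}^2_{\mathbb{C}}$ be a $d$-arrangement of $k\geq 3$ curves, and let $G$ be its Levi graph. Let $S=\mathbb{K}[a_v,b_v : v\in V(G)]$ over a field $\mathbb{K}$ and let $J_G$ be the binomial edge ideal of $G$. Then $S/J_G$ is not Cohen–Macaulay.
   Context: A $d$-arrangement is an arrangement $\mathcal{C}=\{C_1,\dots,C_k\}$ of $k\geq 3$ smooth plane curves all of the same degree $d\geq 1$ such that the singular locus $\mathrm{Sing}(\mathcal{C})$ of the union consists only of ordinary intersection points (locally like intersections of lines). The Levi graph of $\mathcal{C}$ is the bipartite graph with one vertex for each point $p\in\mathrm{Sing}(\mathcal{C})$, one vertex for each curve $C_j$, and an edge between the vertex of $p$ and the vertex of $C_j$ iff $p\in C_j$. For a graph with vertices labelled $1,\dots,n$, the binomial edge ideal $J_G\subseteq \mathbb{K}[a_1,\dots,a_n,b_1,\dots,b_n]$ is generated by $a_ib_j-a_jb_i$ for all edges $\{i,j\}$ with $i<j$. *)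

(* Defs.v *)
From HB Require Import structures.
From mathcomp Require Import all_boot all_order all_algebra.
From mathcomp Require Import mpoly.
From mathcomp Require Import complex.
From mathcomp Require Import reals.

Set Implicit Arguments.
Unset Strict Implicit.
Unset Printing Implicit Defensive.

Import Order.TTheory GRing.Theory Num.Theory.
Local Open Scope ring_scope.

Section CommAlg.
Variables (K : fieldType) (n : nat).

Definition mideal := {mpoly K[n]} -> Prop.

Definition is_ideal (I : mideal) : Prop :=
  I 0 /\ (forall f g, I f -> I g -> I (f + g)) /\ (forall f g, I g -> I (f * g)).

Definition is_prime_ideal (I : mideal) : Prop :=
  is_ideal I /\ ~ I 1 /\ (forall f g, I (f * g) -> I f \/ I g).

Definition is_maximal_ideal (I : mideal) : Prop :=
  is_ideal I /\ ~ I 1 /\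
  (forall I' : mideal, is_ideal I' -> (forall f, I f -> I' f) -> ~ I' 1 ->
     forall f, I' f -> I f).

Definition gen_ideal (gs : seq {mpoly K[n]}) : mideal :=
  fun f => exists cs : seq {mpoly K[n]}, size cs = size gs /\
           f = \sum_(i < size gs) cs`_i * gs`_i.

(* f belongs to the extension of the ideal I to the localization S_P,
   i.e. the image of f in (S/I)_P is zero *)
Definition loc_zero (P : mideal) (I : mideal) (f : {mpoly K[n]}) : Prop :=
  exists u, ~ P u /\ I (u * f).

(* fs = [f_1; ...; f_r] (elements of P) is a regular sequence on the
   local ring (S/J)_P, where J = (js) *)
Definition loc_regular_seq (js : seq {mpoly K[n]}) (P : mideal)
    (fs : seq {mpoly K[n]}) : Prop :=
  (forall f, f \in fs -> P f) /\
  (forall i, (i < size fs)%N -> forall g,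
      loc_zero P (gen_ideal (js ++ take i fs)) (g * fs`_i) ->
      loc_zero P (gen_ideal (js ++ take i fs)) g) /\
  ~ loc_zero P (gen_ideal (js ++ fs)) 1.

(* a chain of prime ideals Q 0 < Q 1 < ... < Q h = P, all containing J;
   these correspond to chains of primes of length h in (S/J)_P *)
Definition prime_chain_to (js : seq {mpoly K[n]}) (P : mideal)
    (Q : nat -> mideal) (h : nat) : Prop :=
  (forall i, (i <= h)%N -> is_prime_ideal (Q i)) /\
  (forall i, (i <= h)%N -> forall f, gen_ideal js f -> Q i f) /\
  (forall i, (i < h)%N -> (forall f, Q i f -> Q i.+1 f) /\
                           exists f, Q i.+1 f /\ ~ Q i f) /\
  (forall f, Q h f <-> P f).

(* (S/J)_P is Cohen-Macaulay: depth = Krull dimension (both finite) *)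
Definition CM_local (js : seq {mpoly K[n]}) (P : mideal) : Prop :=
  exists r : nat,
    (exists fs, size fs = r /\ loc_regular_seq js P fs) /\
    (forall fs, loc_regular_seq js P fs -> (size fs <= r)%N) /\
    (exists Q, prime_chain_to js P Q r) /\
    (forall Q h, prime_chain_to js P Q h -> (h <= r)%N).

Definition CohenMacaulay_quot (js : seq {mpoly K[n]}) : Prop :=
  forall P : mideal, is_maximal_ideal P -> (forall f, gen_ideal js f -> P f) ->
    CM_local js P.

End CommAlg.

Section BEI.
Variables (K : fieldType) (N : nat).

Definition var_a (i : 'I_N) : {mpoly K[N + N]} := 'X_(lshift N i).
Definition var_b (i : 'I_N) : {mpoly K[N + N]} := 'X_(rshift N i).

Definition binomial_edge_gens (e : rel 'I_N) : seq {mpoly K[N + N]} :=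
  [seq var_a p.1 * var_b p.2 - var_a p.2 * var_b p.1
  | p <- enum [pred p : 'I_N * 'I_N | (p.1 < p.2)%N && e p.1 p.2]].

End BEI.

Section Arr.
Variable R : realType.
Local Notation C := (complex R).
Local Notation pt := ('I_3 -> C).

Definition nonzero_pt (v : pt) : Prop := exists l, v l != 0.

Definition proj_eq (v w : pt) : Prop :=
  exists c : C, c != 0 /\ forall l, v l = c * w l.

Definition smooth_curve (d : nat) (F : {mpoly C[3]}) : Prop :=
  F != 0 /\ F \is d.-homog /\
  forall v, nonzero_pt v -> F.@[v] = 0 -> exists l, (mderiv l F).@[v] != 0.

Variable k : nat.
Variable F : 'I_k -> {mpoly C[3]}.

Definition union_poly : {mpoly C[3]} := \prod_(j < k) F j.

Definition sing_pt (v : pt) : Prop :=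
  nonzero_pt v /\ union_poly.@[v] = 0 /\
  forall l, (mderiv l union_poly).@[v] = 0.

Definition grad (j : 'I_k) (v : pt) : pt := fun l => (mderiv l (F j)).@[v].

(* d-arrangement: k distinct smooth curves of degree d whose union has only
   ordinary singularities: at every singular point, the curves passing
   through it meet pairwise transversally (distinct tangent lines). *)
Definition d_arrangement (d : nat) : Prop :=
  (forall j, smooth_curve d (F j)) /\
  (forall i j, i != j ->
     ~ (forall v, nonzero_pt v -> ((F i).@[v] = 0 <-> (F j).@[v] = 0))) /\
  (forall v, sing_pt v -> forall i j, i != j ->
     (F i).@[v] = 0 -> (F j).@[v] = 0 ->
     ~ (exists c : C, forall l, grad i v l = c * grad j v l)).

Definition sing_enumeration (m : nat) (pts : 'I_m -> pt) : Prop :=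
  (forall p, sing_pt (pts p)) /\
  (forall p q, p != q -> ~ proj_eq (pts p) (pts q)) /\
  (forall v, sing_pt v -> exists p, proj_eq v (pts p)).

Definition levi_rel (m : nat) (pts : 'I_m -> pt) : rel 'I_(m + k) :=
  fun x y =>
    match split x, split y with
    | inl p, inr j => (F j).@[pts p] == 0
    | inr j, inl p => (F j).@[pts p] == 0
    | _, _ => false
    end.

End Arr.

(* Main.v *)
(** The unmixedness obstruction: a Cohen-Macaulay local ring has dimension equal
    to its depth, and the depth is at most the dimension of S/p for every
    associated prime p.  Let [T] be a set of vertices of the Levi graph such
    that putting back any vertex of [T] joins components of the graph minus [T].
    It gives a minimal prime of J_G of dimension |V \ T| + c(T), where c(T)
    counts the components of the graph minus [T].

    Every singular point lies on two curves (the curves are smooth) and any two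
    curves meet (resultants); nothing else about the arrangement is used.  With
    m points and k curves, compare with the dimension at least m + k + 1 coming
    from T = {}.
    If k <= m, take for [T] all points: dimension 2k.
    If m < k and at most one curve has a single singular point, take the
    remaining curves: dimension at most 2m + 1.
    If two curves have a single singular point, it is a common point p, which
    then lies on all curves; so T = {} gives dimension exactly m + k + 1, while
    T = {p} gives at least m + k + 2.

    The bound on the depth needs no Noetherian theory.  Let z in S/J_G be
    annihilated by p, with S/p birationally a polynomial ring in s variables.
    More than s elements of S are algebraically dependent modulo p; if they form
    a regular sequence on the localization of S/J_G, killing the relation one
    variable at a time shows that z lies in the ideal they generate.  Powers of
    a regular sequence are again regular, so z lies in arbitrarily high powers of
    the maximal ideal, which an explicit homomorphism to a polynomial ring
    excludes. *)
Require Import Defs.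
From HB Require Import structures.
From mathcomp Require Import all_boot all_order all_algebra.
From mathcomp Require Import mpoly.
From mathcomp Require Import complex.
From mathcomp Require Import reals.
From mathcomp Require Import ring zify.

Set Implicit Arguments.
Unset Strict Implicit.
Unset Printing Implicit Defensive.

Import Order.TTheory GRing.Theory Num.Theory.
Local Open Scope ring_scope.

(** * Regular sequences in a localization *)

Section LocalizedIdeals.
Variables (A : comNzRingType) (U : A -> Prop).

(* An ideal of the localization at [U], represented by its preimage in [A]. *)
Record uideal (I : A -> Prop) : Prop := UIdeal {
  uideal0 : I 0;
  uidealD : forall f g, I f -> I g -> I (f + g);
  uidealM : forall f g, I g -> I (f * g);
  uidealU : forall u f, U u -> I (u * f) -> I f }.

(** The preimage in [A] of the ideal that [I] and [x] generate in the localization; [u] is a common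
    denominator. *)
Definition adj (I : A -> Prop) (x f : A) : Prop :=
  exists u g, U u /\ I (u * f - g * x).

Fixpoint adjs (I : A -> Prop) (xs : seq A) : A -> Prop :=
  if xs is x :: xs' then adjs (adj I x) xs' else I.

Fixpoint regular_mod (I : A -> Prop) (xs : seq A) : Prop :=
  if xs is x :: xs' then
    (forall g, I (g * x) -> I g) /\ regular_mod (adj I x) xs'
  else True.

Hypotheses (U1 : U 1) (UM : forall u v, U u -> U v -> U (u * v)).

Lemma uidealN I f : uideal I -> I f -> I (- f).
Proof. by move=> hI If; rewrite -mulN1r; apply: uidealM. Qed.

Lemma uidealB I f g : uideal I -> I f -> I g -> I (f - g).
Proof. by move=> hI If Ig; apply: uidealD => //; apply: uidealN. Qed.

Lemma uideal_sum I (J : Type) (r : seq J) (Q : pred J) (F : J -> A) :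
  uideal I -> (forall j, Q j -> I (F j)) -> I (\sum_(j <- r | Q j) F j).
Proof.
by move=> hI hF; apply: big_ind => //; [apply: uideal0 | apply: uidealD].
Qed.

Lemma adj_uideal I x : uideal I -> uideal (adj I x).
Proof.
move=> hI; split.
- by exists 1, 0; split=> //; rewrite mulr0 mul0r subr0; apply: uideal0.
- move=> f1 f2 [u1 [g1 [Uu1 I1]]] [u2 [g2 [Uu2 I2]]].
  exists (u1 * u2), (u2 * g1 + u1 * g2); split; first exact: UM.
  have -> : u1 * u2 * (f1 + f2) - (u2 * g1 + u1 * g2) * x
          = u2 * (u1 * f1 - g1 * x) + u1 * (u2 * f2 - g2 * x) by ring.
  by apply: uidealD => //; apply: uidealM.
- move=> f1 f2 [u [g [Uu I2]]]; exists u, (f1 * g); split=> //.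
  have -> : u * (f1 * f2) - f1 * g * x = f1 * (u * f2 - g * x) by ring.
  exact: uidealM.
- move=> u f Uu [v [g [Uv Ig]]]; exists (v * u), g; split; first exact: UM.
  by rewrite -mulrA.
Qed.

Lemma adj_sub I x f : uideal I -> I f -> adj I x f.
Proof.
by move=> hI If; exists 1, 0; split=> //; rewrite mul1r mul0r subr0.
Qed.

Lemma adj_gen I x g : uideal I -> adj I x (g * x).
Proof.
by move=> hI; exists 1, g; split=> //; rewrite mul1r subrr; apply: uideal0.
Qed.

Lemma adj_least I W x f :
  uideal W -> (forall g, I g -> W g) -> W x -> adj I x f -> W f.
Proof.
move=> hW sIW Wx [u [g [Uu /sIW Wg]]]; apply: (uidealU hW Uu).
by rewrite -[u * f](subrK (g * x)); apply: uidealD => //; apply: uidealM.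
Qed.

Lemma adjs_least I W xs f :
  uideal W -> (forall g, I g -> W g) -> (forall x, x \in xs -> W x) ->
  adjs I xs f -> W f.
Proof.
move=> hW; elim: xs I => [|x xs IH] I sIW Wxs /=; first exact: sIW.
apply: IH => [g|y yxs]; last by apply: Wxs; rewrite inE yxs orbT.
by apply: adj_least => //; apply: Wxs; rewrite inE eqxx.
Qed.

Lemma adj_mono I I' x f :
  (forall g, I g -> I' g) -> adj I x f -> adj I' x f.
Proof. by move=> sI [u [g [Uu Ig]]]; exists u, g; split=> //; apply: sI. Qed.

Lemma regular_mod_ext I I' xs :
  (forall g, I g <-> I' g) -> regular_mod I xs -> regular_mod I' xs.
Proof.
elim: xs I I' => [|x xs IH] I I' eqI //= [regx regxs]; split.
  by move=> g /eqI /regx /eqI.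
by apply: IH regxs => g; split; apply: adj_mono => h /eqI.
Qed.

(* Elementwise form of an exact sequence 0 -> A/I1 -x-> A/I2 -> A/I3 -> 0. *)
Definition exact_triple (x : A) (I1 I2 I3 : A -> Prop) : Prop :=
  (forall f, I1 f <-> I2 (f * x)) /\ (forall f, I3 f <-> adj I2 x f).

(** Reducing the exact sequence modulo the first element keeps it exact, because that element is
    regular on the right end (snake lemma); so induction on the sequence applies. *)
Lemma exact_triple_regular x I1 I2 I3 xs :
  uideal I1 -> uideal I2 -> uideal I3 -> exact_triple x I1 I2 I3 ->
  regular_mod I1 xs -> regular_mod I3 xs -> regular_mod I2 xs.
Proof.
elim: xs I1 I2 I3 => [|t xs IH] I1 I2 I3 h1 h2 h3 [e1 e3] //=.
move=> [reg1 regs1] [reg3 regs3].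
have sub23 g : I2 g -> I3 g by move=> I2g; apply/e3; apply: adj_sub.
have key g : I3 (g * t) -> exists u h, U u /\ I2 (u * g - h * x).
  by move=> /reg3 /e3.
split.
  move=> g I2gt; have [u [h [Uu I2g]]] := key g (sub23 _ I2gt).
  have I1h : I1 h.
    apply: reg1; apply/e1.
    have -> : h * t * x = u * (g * t) - t * (u * g - h * x) by ring.
    by apply: uidealB => //; apply: uidealM.
  apply: (uidealU h2 Uu); rewrite -[u * g](subrK (h * x)).
  by apply: uidealD => //; apply/e1.
(* In the reduced triple, injectivity on the left is the inclusion that uses regularity of [t]
   modulo [I3], through [key]. *)
apply: (IH (adj I1 t) _ (adj I3 t)) => //; try exact: adj_uideal.
split=> f; split.
- move=> [u [g [Uu /e1 I2f]]]; exists u, (g * x); split=> //.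
  by have -> : u * (f * x) - g * x * t = (u * f - g * t) * x by ring.
- move=> [u [g [Uu I2f]]].
  have /key [v [h [Uv I2g]]] : I3 (g * t).
    have -> : g * t = (u * f) * x - (u * (f * x) - g * t) by ring.
    apply: uidealB => //; last exact: sub23.
    by apply/e3; apply: adj_gen.
  exists (v * u), h; split; first exact: UM.
  apply/e1.
  have -> : (v * u * f - h * t) * x
     = v * (u * (f * x) - g * t) + t * (v * g - h * x) by ring.
  by apply: uidealD => //; apply: uidealM.
- move=> [u [g [Uu /e3 [v [h [Uv I2f]]]]]].
  exists (v * u), h; split; first exact: UM.
  exists 1, (v * g); split=> //.
  have -> : 1 * (v * u * f - h * x) - v * g * t
     = v * (u * f - g * t) - h * x by ring.
  by [].
- move=> [u [h [Uu [v [g [Uv I2f]]]]]].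
  exists (v * u), g; split; first exact: UM.
  apply/e3; exists 1, (v * h); split=> //.
  by have -> : 1 * (v * u * f - g * t) - v * h * x
     = v * (u * f - h * x) - g * t by ring.
Qed.

(** Induction along 0 -> A/(x^(n+1)) -> A/(x^(n+2)) -> A/(x) -> 0, taken modulo [I], where the first
    map is multiplication by x. *)
Lemma regular_mod_pow_head I x xs n :
  uideal I -> regular_mod I (x :: xs) -> regular_mod I (x ^+ n.+1 :: xs).
Proof.
move=> hI [regx regxs]; elim: n => [|n [regn regsn]]; first by rewrite expr1.
split.
  by move=> g; rewrite exprSr mulrA => /regx /regn.
apply: (@exact_triple_regular x (adj I (x ^+ n.+1)) _ (adj I x)) => //;
  try exact: adj_uideal.
split=> f; split.
- move=> [u [g [Uu If]]]; exists u, g; split=> //.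
  have -> : u * (f * x) - g * x ^+ n.+2 = x * (u * f - g * x ^+ n.+1).
    by rewrite [x ^+ n.+2]exprSr; ring.
  exact: uidealM.
- move=> [u [g [Uu If]]]; exists u, g; split=> //.
  apply: regx; move: If.
  by rewrite [x ^+ n.+2]exprSr mulrA mulrA -mulrBl.
- move=> [u [g [Uu If]]]; exists u, g; split=> //.
  exact: adj_sub.
- move=> [u [g [Uu [v [h [Uv If]]]]]].
  exists (v * u), (v * g + h * x ^+ n.+1); split; first exact: UM.
  have -> : v * u * f - (v * g + h * x ^+ n.+1) * x
     = v * (u * f - g * x) - h * x ^+ n.+2.
    by rewrite [x ^+ n.+2]exprSr; ring.
  by [].
Qed.

Lemma regular_mod_pow I xs n :
  uideal I -> regular_mod I xs -> regular_mod I [seq x ^+ n.+1 | x <- xs].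
Proof.
elim: xs I => [|x xs IH] I hI // regI.
have [regx regxs] := regular_mod_pow_head n hI regI.
by split=> //; apply: IH => //; apply: adj_uideal.
Qed.

End LocalizedIdeals.

(** * Algebraic dependence *)

Section Relations.
Variables (K : fieldType) (A : comAlgType K).

(* The polynomial in [ys] of degree < B in each variable, whose coefficient at
   the exponents (j_1, ..., j_r) is [c] at the integer with base-[B] digits
   j_1, ..., j_r, least significant first. *)
Fixpoint ev (B : nat) (c : nat -> K) (ys : seq A) : A :=
  if ys is y :: ys' then
    \sum_(j < B) y ^+ j * ev B (fun i => c (i * B + j)%N) ys'
  else (c 0)%:A.

Lemma ev_lincomb B (J : finType) (v : J -> K) (d : J -> nat -> K) ys :
  ev B (fun i => \sum_l v l * d l i) ys = \sum_l v l *: ev B (d l) ys.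
Proof.
elim: ys d => [|y ys IH] d /=.
  by rewrite scaler_suml; apply: eq_bigr => l _; rewrite scalerA.
under eq_bigr => j _ do rewrite IH mulr_sumr.
rewrite exchange_big /=; apply: eq_bigr => l _.
by rewrite scaler_sumr; apply: eq_bigr => j _; rewrite scalerAr.
Qed.

Lemma ev_eq0 B c ys :
  (forall i, (i < B ^ size ys)%N -> c i = 0) -> ev B c ys = 0.
Proof.
elim: ys c => [|y ys IH] c /= c0; first by rewrite c0 ?scale0r.
rewrite big1 // => j _; rewrite IH ?mulr0 // => i lti.
apply: c0; have ltj := ltn_ord j; rewrite expnS.
by move: lti; move: (B ^ _)%N => t; nia.
Qed.

Lemma sum_pow_factor B (E : nat -> A) (y : A) j0 :
  (j0 < B)%N -> (forall j, (j < j0)%N -> E j = 0) ->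
  exists r, \sum_(j < B) y ^+ j * E j = (E j0 + r * y) * y ^+ j0.
Proof.
move=> ltj0 E0.
exists (\sum_(j < B | (j0 < j)%N) y ^+ (j - j0.+1) * E j).
rewrite (bigID (fun j : 'I_B => (j0 < j)%N)) /= addrC mulrDl; congr (_ + _).
  rewrite (bigD1 (Ordinal ltj0)) /= ?ltnn // big1 ?addr0 1?mulrC // => j.
  rewrite -leqNgt => /andP[lej nej]; rewrite E0 ?mulr0 //.
  by rewrite ltn_neqAle lej andbT; apply: contra nej => /eqP ej; apply/eqP/val_inj.
rewrite !mulr_suml; apply: eq_bigr => j ltj.
have -> : y ^+ j = y ^+ (j - j0.+1) * y * y ^+ j0.
  by rewrite -mulrA -exprS -exprD subnK.
by rewrite -!mulrA; congr (_ * _); rewrite mulrA [LHS]mulrC.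
Qed.

Variable U : A -> Prop.
Hypotheses (U1 : U 1) (UM : forall u v, U u -> U v -> U (u * v))
  (UC : forall a : K, a != 0 -> U a%:A).

(* Cancel the least power of the first element occurring in the relation, then
   reduce modulo that element. *)
Lemma relation_in_adjs I B c ys z i0 :
  uideal U I -> regular_mod U I ys ->
  (i0 < B ^ size ys)%N -> c i0 != 0 -> I (ev B c ys * z) -> adjs U I ys z.
Proof.
elim: ys I c i0 => [|y ys IH] I c i0 hI /=.
  rewrite expn0 ltnS leqn0 => _ /eqP-> c0 Icz.
  exact: (uidealU hI (UC c0)).
move=> [regy regys] lti0 ci0 Iev.
have B0 : (0 < B)%N by move: lti0; rewrite expnS; case: (B).
(* [Q j]: the power [y ^+ j] occurs in the relation. The lowest base-[B] digit of an index is the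
   exponent of [y]. *)
pose Q j := (j < B)%N && [exists q : 'I_(B ^ size ys), c (q * B + j)%N != 0].
have exQ : exists j, Q j.
  exists (i0 %% B)%N; rewrite /Q ltn_mod B0 /=.
  have ltq : (i0 %/ B < B ^ size ys)%N by rewrite ltn_divLR // -expnSr.
  by apply/existsP; exists (Ordinal ltq); rewrite /= -divn_eq.
case: (ex_minnP exQ) => j0 /andP[ltj0 /existsP[q cq]] minj0.
have [|r Er] := @sum_pow_factor B (fun j => ev B (fun i => c (i * B + j)%N) ys) y j0 ltj0.
  move=> j ltj; apply: ev_eq0 => i lti; apply/eqP; apply/negPn/negP => ci.
  have /minj0 : Q j.
    rewrite /Q (ltn_trans ltj ltj0); apply/existsP; by exists (Ordinal lti).
  by rewrite leqNgt ltj.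
move: Iev; rewrite Er; set w := _ + _ => Iev.
have Iw : I (w * z).
  move: Iev; rewrite mulrAC; elim: (j0) => [|n IHn]; first by rewrite expr0 mulr1.
  by rewrite exprSr mulrA => /regy.
(* Modulo [y], the factor [w] becomes the coefficient of [y ^+ j0], which is a nontrivial polynomial
   in the remaining elements. *)
apply: (IH _ (fun i => c (i * B + j0)%N) q) => //; first exact: adj_uideal.
exists 1, (- (r * z)); split=> //.
suff -> : 1 * (ev B (fun i => c (i * B + j0)%N) ys * z) - - (r * z) * y = w * z by [].
by rewrite /w mul1r mulNr opprK mulrDl; congr (_ + _); rewrite mulrAC.
Qed.

End Relations.

(** * Total degree bounds and a count of monomials *)

Section DegreeBound.
Variables (K : fieldType) (n : nat).
Implicit Types f g : {mpoly K[n]}.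

(** [msize] is the total degree plus one, and 0 on the zero polynomial, which thus meets every
    bound. *)
Definition deg_le D f := (msize f <= D.+1)%N.

Lemma deg_leM D E f g : deg_le D f -> deg_le E g -> deg_le (D + E) (f * g).
Proof.
rewrite /deg_le => hf hg.
have [->|f0] := eqVneq f 0; first by rewrite mul0r msize0.
have [->|g0] := eqVneq g 0; first by rewrite mulr0 msize0.
move: hf hg; rewrite msizeM //; move: (mmeasure _ f) (mmeasure _ g) => a b; lia.
Qed.

Lemma deg_leC D (c : K) : deg_le D c%:MP.
Proof. by rewrite /deg_le msizeC; case: (_ != _). Qed.

Lemma deg_leX D f m : deg_le D f -> deg_le (m * D) (f ^+ m).
Proof.
move=> hf; elim: m => [|m IH]; first by rewrite expr0; apply: deg_leC.
by rewrite exprS mulSn; apply: deg_leM.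
Qed.

Lemma deg_leZ D c f : deg_le D f -> deg_le D (c *: f).
Proof. by move=> hf; apply: leq_trans (msizeZ_le _ _) hf. Qed.

Lemma deg_leW D E f : (D <= E)%N -> deg_le D f -> deg_le E f.
Proof. by move=> leDE /leq_trans; apply. Qed.

Lemma deg_le_sum (J : Type) (r : seq J) (Q : pred J) D (F : J -> {mpoly K[n]}) :
  (forall j, Q j -> deg_le D (F j)) -> deg_le D (\sum_(j <- r | Q j) F j).
Proof.
move=> hF; apply: (big_ind (deg_le D)) => //; first by rewrite /deg_le msize0.
move=> f g hf hg; apply: leq_trans (mmeasureD_le _ _ _) _.
by rewrite geq_max; apply/andP.
Qed.

Lemma deg_le_prod (J : finType) (D : J -> nat) (F : J -> {mpoly K[n]}) :
  (forall j, deg_le (D j) (F j)) -> deg_le (\sum_j D j) (\prod_j F j).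
Proof.
move=> hF; apply: (big_rec2 (fun D f => deg_le D f)).
  by rewrite -mpolyC1; apply: deg_leC.
by move=> j E f _ hE; apply: deg_leM.
Qed.

Lemma deg_le_bounded (ys : seq {mpoly K[n]}) :
  exists D, forall y, y \in ys -> deg_le D y.
Proof.
elim: ys => [|y ys [D hD]]; first by exists 0%N.
exists (D + msize y)%N => f; rewrite inE => /orP[/eqP->|/hD].
  by rewrite /deg_le; lia.
by apply: deg_leW; lia.
Qed.

Lemma deg_le_ev B c (ys : seq {mpoly K[n]}) D :
  (forall y, y \in ys -> deg_le D y) -> deg_le (size ys * (B * D)) (ev B c ys).
Proof.
elim: ys c => [|y ys IH] c hys /=.
  by rewrite /deg_le -mpolyC1 (leq_trans (msizeZ_le _ _)) // mpolyC1 msize1.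
apply: deg_le_sum => j _; rewrite mulSn; apply: deg_leM; last first.
  by apply: IH => f fys; apply: hys; rewrite inE fys orbT.
apply: deg_leW (deg_leX _ (hys y (mem_head _ _))).
by rewrite leq_mul2r ltnW ?orbT.
Qed.

Lemma card_bmultinom_le b : (#|{: 'X_{1..n < b.+1}}| <= b.+1 ^ n)%N.
Proof.
pose h (m : 'X_{1..n < b.+1}) := [ffun i : 'I_n => inord (m i) : 'I_b.+1].
have hinj : injective h.
  move=> m1 m2 /ffunP eqm; apply/val_inj/mnmP => i.
  have ltm (m : 'X_{1..n < b.+1}) : (m i < b.+1)%N.
    apply: leq_ltn_trans (bmdeg m); rewrite mdegE (bigD1 i) //=.
    exact: leq_addr.
  by move: (eqm i) => /(congr1 val); rewrite !ffunE /= !inordK.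
by have := leq_card h hinj; rewrite card_ffun !card_ord.
Qed.

End DegreeBound.

(** * Dependence of more than s elements, by counting dimensions *)

Section Dependence.
Variables (K : fieldType) (n s : nat).
Local Notation S := {mpoly K[n]}.
Variables (U : S -> Prop) (I : S -> Prop) (x : 'I_s -> S)
  (e : {mpoly K[s]}) (rho : 'I_n -> {mpoly K[s]}).
Local Notation iota := (mmap (@mpolyC n K) x).
Hypotheses (U1 : U 1) (UM : forall u v, U u -> U v -> U (u * v))
  (hI : uideal U I) (Ue : U (iota e))
  (hrho : forall i, I (iota e * 'X_i - iota (rho i))).

Let eqI f g := I (f - g).

Let eqI_mul f g f' g' : eqI f g -> eqI f' g' -> eqI (f * f') (g * g').
Proof.
rewrite /eqI => h h'.
have -> : f * f' - g * g' = f' * (f - g) + g * (f' - g') by ring.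
by apply: (uidealD hI); apply: (uidealM hI).
Qed.

(** Clears denominators: modulo [I] each variable is [rho i] over [e], so [e ^+ M] times a monomial
    of degree at most [M] becomes a polynomial in the [x j]. *)
Let lift_monomial M (m : 'X_{1..n}) : {mpoly K[s]} :=
  e ^+ (M - mdeg m) * mmap1 rho m.

Let lift_monomialP M (m : 'X_{1..n}) : (mdeg m <= M)%N ->
  eqI (iota e ^+ M * 'X_[m]) (iota (lift_monomial M m)).
Proof.
move=> lem; rewrite /lift_monomial rmorphM rmorphXn /=.
rewrite -{1}(subnK lem) exprD -mulrA.
have eqI_refl f : eqI f f by rewrite /eqI subrr; apply: (uideal0 hI).
apply: eqI_mul => //.
rewrite mpolyXE_id mdegE expr_sum -big_split /= /mmap1 rmorph_prod /=.
apply: (big_ind2 eqI) => // i _.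
rewrite -exprMn rmorphXn /=; elim: (m i) => [|k IH]; first by rewrite !expr0.
by rewrite !exprS; apply: eqI_mul => //; apply: hrho.
Qed.

Let lift M (f : S) : {mpoly K[s]} :=
  \sum_(m : 'X_{1..n < M.+1}) f@_m *: lift_monomial M m.

Let iotaZ c f : iota (c *: f) = c *: iota f.
Proof. by rewrite mmapZ mul_mpolyC. Qed.

Let liftP M f : deg_le M f -> eqI (iota e ^+ M * f) (iota (lift M f)).
Proof.
move=> hf; rewrite /eqI {1}(mpolywE hf) /lift rmorph_sum mulr_sumr -sumrB /=.
apply: (uideal_sum (U := U)) => // m _.
rewrite iotaZ -scalerAr -scalerBr -mul_mpolyC.
by apply: (uidealM hI); apply: lift_monomialP; rewrite -ltnS bmdeg.
Qed.

Let lift_lincomb M (J : finType) (v : J -> K) (F : J -> S) :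
  lift M (\sum_l v l *: F l) = \sum_l v l *: lift M (F l).
Proof.
under [RHS]eq_bigr => l _ do rewrite scaler_sumr.
rewrite exchange_big /=; apply: eq_bigr => m _.
rewrite raddf_sum scaler_suml; apply: eq_bigr => l _ /=.
by rewrite mcoeffZ scalerA.
Qed.

(* There are B^(size ys) coefficients, but the lifts to [{mpoly K[s]}] live in
   a space of dimension O(B^s). *)
Lemma algebraic_dependence (ys : seq S) : (s < size ys)%N ->
  exists B c i0, [/\ (i0 < B ^ size ys)%N, c i0 != 0 & I (ev B c ys)].
Proof.
move=> lts; set r := size ys.
have [Dy hDy] := deg_le_bounded ys.
have [De hDe] := deg_le_bounded (e :: codom rho).
(* [M] bounds the degree of [ev] and [b] that of the lifts. Here b + 1 <= B * E and E ^ s < B, so (b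
   + 1) ^ s <= (B * E) ^ s < B ^ (s + 1) <= B ^ r. *)
pose E := (r * Dy * De).+1; pose B := (E ^ s).+1.
pose M := (r * (B * Dy))%N.
pose b := (M * De)%N.
have lift_deg f : deg_le b (lift M f).
  apply: deg_le_sum => m _; apply: deg_leZ; rewrite /lift_monomial.
  have lem : (mdeg m <= M)%N by rewrite -ltnS bmdeg.
  have -> : b = ((M - mdeg m) * De + mdeg m * De)%N by rewrite -mulnDl subnK.
  apply: deg_leM; first by apply: deg_leX; apply: hDe; rewrite mem_head.
  rewrite mdegE big_distrl /=; apply: deg_le_prod => i; apply: deg_leX.
  by apply: hDe; rewrite inE codom_f orbT.
have lt_card : (#|{: 'X_{1..s < b.+1}}| < B ^ r)%N.
  apply: leq_ltn_trans (card_bmultinom_le _ _) _.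
  have leb : (b.+1 <= B * E)%N.
    rewrite /b /M /E; have : (0 < B)%N by []. 
    move: (B) => B'; nia.
  apply: (@leq_ltn_trans ((B * E) ^ s)).
    by case: (posnP s) => [->|s_gt0]; rewrite ?expn0 ?leq_exp2r.
  rewrite expnMn; apply: (@leq_trans (B ^ s.+1)); last first.
    by rewrite leq_exp2l // /B ltnS expn_gt0.
  by rewrite expnSr ltn_pmul2l ?expn_gt0 // /B.
(* [d l] selects the l-th monomial in [ys]. The coefficient matrix of the lifts has more rows than
   columns, so its left kernel gives a nonzero [c] whose relation lifts to 0. *)
pose d l i : K := (l == i :> nat)%:R.
pose W (l : 'I_(B ^ r)) := lift M (ev B (d l) ys).
pose X : 'M[K]_(B ^ r, #|{: 'X_{1..s < b.+1}}|) :=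
  \matrix_(l, t) (W l)@_(enum_val t : 'X_{1..s < b.+1}).
have /rowV0Pn[v /sub_kermxP vX v0] : kermx X != 0.
  rewrite kermx_eq0 /row_free neq_ltn; apply/orP; left.
  exact: leq_ltn_trans (rank_leq_col _) lt_card.
pose c i := \sum_l v 0 l * d l i.
have [l0 vl0] : exists l, v 0 l != 0.
  apply/existsP; apply: contra_neqT v0 => /existsPn v0.
  by apply/rowP => l; rewrite mxE; apply/eqP/negPn/v0.
have evE : ev B c ys = \sum_l v 0 l *: ev B (d l) ys by apply: ev_lincomb.
have lift0 : lift M (ev B c ys) = 0.
  rewrite (mpolywE (lift_deg (ev B c ys))) big1 // => m _.
  rewrite evE lift_lincomb raddf_sum /=.
  have /rowP/(_ (enum_rank m)) := vX; rewrite !mxE => vX0.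
  rewrite (_ : \sum_i _ = 0) ?scale0r // -[RHS]vX0.
  by apply: eq_bigr => l _; rewrite mcoeffZ mxE enum_rankK.
exists B, c, l0; split=> //.
  rewrite /c (bigD1 l0) //= /d eqxx mulr1 big1 ?addr0 // => l nel.
  by rewrite -val_eqE in nel; rewrite (negPf nel) mulr0.
have UeM k : U (iota e ^+ k).
  by elim: k => [|k IHk]; rewrite ?expr0 // exprS; apply: UM.
apply: (uidealU hI (UeM M)).
have := liftP (deg_le_ev B c hDy : deg_le M _).
by rewrite /eqI lift0 rmorph0 subr0.
Qed.
End Dependence.

(** * A bound on the depth at a rational point *)

Section GeneratedIdeals.
Variables (K : fieldType) (n : nat).
Local Notation S := {mpoly K[n]}.

Lemma gen_ideal_is_ideal (gs : seq S) : is_ideal (gen_ideal gs).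
Proof.
split; [|split].
- exists (nseq (size gs) 0); rewrite size_nseq; split=> //.
  by rewrite big1 // => i _; rewrite nth_nseq ltn_ord mul0r.
- move=> f g [cs [scs ->]] [ds [sds ->]].
  exists (mkseq (fun i => cs`_i + ds`_i) (size gs)); rewrite size_mkseq; split=> //.
  by rewrite -big_split; apply: eq_bigr => i _; rewrite nth_mkseq // mulrDl.
- move=> f g [cs [scs ->]].
  exists (mkseq (fun i => f * cs`_i) (size gs)); rewrite size_mkseq; split=> //.
  by rewrite mulr_sumr; apply: eq_bigr => i _; rewrite nth_mkseq // mulrA.
Qed.

Lemma gen_ideal_rcons (gs : seq S) x f :
  gen_ideal (rcons gs x) f <-> exists g, gen_ideal gs (f - g * x).
Proof.
have nthr i (cs : seq S) y : (i < size cs)%N -> (rcons cs y)`_i = cs`_i.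
  by move=> lti; rewrite nth_rcons lti.
have nthl (cs : seq S) y m : size cs = m -> (rcons cs y)`_m = y.
  by move=> <-; rewrite nth_rcons ltnn eqxx.
split=> [[cs [scs ->]]|[g [cs [scs Ef]]]].
  move: scs; rewrite size_rcons; case/lastP: cs => // cs c.
  rewrite size_rcons => -[scs]; exists c, cs; split=> //.
  rewrite big_ord_recr /= !nthl // addrK; apply: eq_bigr => i _.
  by rewrite !nthr ?scs.
exists (rcons cs g); rewrite !size_rcons scs; split=> //.
rewrite big_ord_recr /= !nthl // -[LHS](subrK (g * x)) Ef; congr (_ + _).
by apply: eq_bigr => i _; rewrite !nthr ?scs.
Qed.

Lemma gen_ideal_mem (gs : seq S) x : x \in gs -> gen_ideal gs x.
Proof.
move=> xgs; have [_ [_ hM]] := gen_ideal_is_ideal gs.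
have ltx : (index x gs < size gs)%N by rewrite index_mem.
exists (mkseq (fun i => (i == index x gs)%:R) (size gs)); rewrite size_mkseq.
split=> //; rewrite (bigD1 (Ordinal ltx)) //= nth_mkseq // eqxx mul1r nth_index //.
rewrite big1 ?addr0 // => i nei; rewrite nth_mkseq //.
by rewrite -val_eqE /= in nei; rewrite (negPf nei) mul0r.
Qed.

Lemma gen_ideal_least (gs : seq S) (I : S -> Prop) f :
  is_ideal I -> (forall g, g \in gs -> I g) -> gen_ideal gs f -> I f.
Proof.
move=> [I0 [ID IM]] sgsI [cs [scs ->]].
apply: big_ind => // i _; apply: IM; apply: sgsI; exact: mem_nth.
Qed.

Lemma ker_is_ideal (T : nzRingType) (h : {rmorphism S -> T}) :
  is_ideal (fun f => h f = 0).
Proof.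
split; first exact: rmorph0.
split=> [f g hf hg|f g hg]; first by rewrite rmorphD hf hg addr0.
by rewrite rmorphM hg mulr0.
Qed.

Lemma ker_is_prime (T : idomainType) (h : {rmorphism S -> T}) :
  is_prime_ideal (fun f => h f = 0).
Proof.
split; first exact: ker_is_ideal.
split; first by rewrite rmorph1; apply/eqP; apply: oner_neq0.
move=> f g /eqP; rewrite rmorphM mulf_eq0 => /orP[] /eqP ->; by [left|right].
Qed.

End GeneratedIdeals.

Section RationalPoint.
Variables (K : fieldType) (n : nat) (pt : 'I_n -> K).
Local Notation S := {mpoly K[n]}.

Definition vanish_at : mideal K n := fun f => f.@[pt] = 0.

Definition nonvanish_at (f : S) : Prop := ~ vanish_at f.

Lemma vanish_at_maximal : is_maximal_ideal vanish_at.
Proof.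
have hP : is_ideal vanish_at.
  split; first exact: meval0.
  rewrite /vanish_at; split=> [f g hf hg|f g hg].
    by rewrite mevalD hf hg addr0.
  by rewrite mevalM hg mulr0.
split=> //; split.
  by rewrite /vanish_at meval1; apply/eqP; apply: oner_neq0.
move=> I [I0 [ID IM]] sPI nI1 f If; rewrite /vanish_at.
apply/eqP/negPn/negP => fpt; apply: nI1.
set c := f.@[pt] in fpt.
have -> : 1 = c^-1%:MP * f + (- c^-1)%:MP * (f - c%:MP) :> S.
  by rewrite !mpolyCN mulNr mulrBr -mpolyCM mulVf // mpolyC1; ring.
apply: ID; first exact: IM.
by apply: IM; apply: sPI; rewrite /vanish_at mevalB mevalC subrr.
Qed.

Lemma nonvanish_at1 : nonvanish_at 1.
Proof. by rewrite /nonvanish_at /vanish_at meval1; apply/eqP/oner_neq0. Qed.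

Lemma nonvanish_atM u v :
  nonvanish_at u -> nonvanish_at v -> nonvanish_at (u * v).
Proof.
rewrite /nonvanish_at /vanish_at mevalM => /eqP hu /eqP hv.
by apply/eqP; apply: mulf_neq0.
Qed.

Lemma loc_zero_uideal I : is_ideal I -> uideal nonvanish_at (loc_zero vanish_at I).
Proof.
move=> [I0 [ID IM]]; split.
- by exists 1; split; [apply: nonvanish_at1 | rewrite mulr0].
- move=> f g [u [Uu If]] [v [Uv Ig]]; exists (u * v).
  split; first exact: nonvanish_atM.
  have -> : u * v * (f + g) = v * (u * f) + u * (v * g) by ring.
  by apply: ID; apply: IM.
- move=> f g [u [Uu Ig]]; exists u; split=> //.
  by rewrite mulrCA; apply: IM.
- move=> u f Uu [v [Uv If]]; exists (v * u); split; first exact: nonvanish_atM.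
  by rewrite -mulrA.
Qed.

Lemma loc_zero_rcons js x f :
  loc_zero vanish_at (gen_ideal (rcons js x)) f <->
  adj nonvanish_at (loc_zero vanish_at (gen_ideal js)) x f.
Proof.
split.
  move=> [u [Uu /gen_ideal_rcons [g Jg]]]; exists u, g; split=> //.
  by exists 1; split; [apply: nonvanish_at1 | rewrite mul1r].
move=> [u [g [Uu [v [Uv Jf]]]]]; exists (v * u); split; first exact: nonvanish_atM.
apply/gen_ideal_rcons; exists (v * g); move: Jf.
by rewrite mulrBr !mulrA.
Qed.

Lemma loc_regular_seq_regular_mod js fs :
  loc_regular_seq js vanish_at fs ->
  regular_mod nonvanish_at (loc_zero vanish_at (gen_ideal js)) fs.
Proof.
case=> _ [reg _]; elim: fs js reg => [|x fs IH] js //= reg; split.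
  by move=> g; have := reg 0%N isT g; rewrite cats0.
apply: regular_mod_ext (loc_zero_rcons js x) (IH (rcons js x) _) => i lti g.
by have := reg i.+1 lti g; rewrite /= cat_rcons.
Qed.

Section DepthBound.
Variables (D : idomainType) (theta : {rmorphism S -> {poly D}}).
Hypothesis theta0 : forall f, vanish_at f -> (theta f)`_0 = 0.

(** Up to an element vanishing at [pt], [u] is a nonzero scalar, and the image of a nonzero scalar
    has an invertible constant coefficient. *)
Lemma theta_nonvanish u : nonvanish_at u -> (theta u)`_0 != 0.
Proof.
move=> /eqP; set c := u.@[pt] => c0.
have /theta0 : vanish_at (u - c%:MP) by rewrite /vanish_at mevalB mevalC subrr.
rewrite rmorphB coefB => /eqP; rewrite subr_eq0 => /eqP ->.
have : (theta c%:MP * theta c^-1%:MP)`_0 = 1.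
  by rewrite -rmorphM -mpolyCM divff // rmorph1 coef1.
rewrite coef0M => h; apply/eqP => h0; move/eqP: h.
by rewrite h0 mul0r eq_sym oner_eq0.
Qed.

(* The contraction along [theta] of the ideal generated by X^N. *)
Definition order_ge N (f : S) : Prop := forall i, (i < N)%N -> (theta f)`_i = 0.

Lemma order_ge_uideal N : uideal nonvanish_at (order_ge N).
Proof.
split.
- by move=> i _; rewrite rmorph0 coef0.
- by move=> f g hf hg i lti; rewrite rmorphD coefD hf ?hg ?addr0.
- move=> f g hg i lti; rewrite rmorphM coefM big1 // => j _.
  by rewrite hg ?mulr0 // (leq_ltn_trans (leq_subr _ _)).
(* Coefficient [i] of the product is (theta u)_0 (theta f)_i plus terms containing lower
   coefficients of [theta f], which vanish by induction. *)
- move=> u f Uu huf i; elim/ltn_ind: i => i IH lti.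
  have := huf i lti; rewrite rmorphM coefM big_ord_recl /= subn0 big1.
    rewrite addr0 => /eqP; rewrite mulf_eq0 (negPf (theta_nonvanish Uu)).
    by move/eqP.
  move=> j _; rewrite [(theta f)`__]IH ?mulr0 //.
    by case: (i) j => [[]//|i' j]; rewrite /= /bump /= add1n subSS ltnS leq_subr.
  by apply: leq_ltn_trans lti; apply: leq_subr.
Qed.

Lemma order_ge_pow y N : vanish_at y -> order_ge N (y ^+ N).
Proof.
move=> /theta0 y0 i lti; rewrite rmorphXn.
have /factor_theorem[q ->] : root (theta y) 0 by rewrite /root horner_coef0 y0.
by rewrite subr0 exprMn coefMXn lti.
Qed.

(* The condition on [rho] says that modulo the annihilator of [z] the local ring
   is generated, up to inverting [e], by the [s] elements [x j]; [theta] shows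
   that [z] is not in every power of the maximal ideal. *)
Theorem depth_bound (s : nat) (js : seq S) (x : 'I_s -> S)
    (e : {mpoly K[s]}) (rho : 'I_n -> {mpoly K[s]}) (z : S) fs :
  (forall f, f \in js -> theta f = 0) -> theta z != 0 ->
  nonvanish_at (mmap (@mpolyC n K) x e) ->
  (forall i, loc_zero vanish_at (gen_ideal js)
     ((mmap (@mpolyC n K) x e * 'X_i - mmap (@mpolyC n K) x (rho i)) * z)) ->
  loc_regular_seq js vanish_at fs -> (size fs <= s)%N.
Proof.
move=> theta_js theta_z Ue hrho regfs; rewrite leqNgt; apply/negP => lts.
have U1 := nonvanish_at1; have UM := nonvanish_atM.
set J := loc_zero vanish_at (gen_ideal js) in hrho.
have hJ : uideal nonvanish_at J by apply/loc_zero_uideal/gen_ideal_is_ideal.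
(* The annihilator of [z] in the localized quotient. *)
pose Iz f := J (f * z).
have hIz : uideal nonvanish_at Iz.
  split; rewrite /Iz.
  - by rewrite mul0r; apply: uideal0 hJ.
  - by move=> f g; rewrite mulrDl; apply: (uidealD hJ).
  - by move=> f g; rewrite -mulrA; apply: (uidealM hJ).
  - by move=> u f Uu; rewrite -mulrA; apply: (uidealU hJ).
(* One more than the degree of [theta z], so [order_ge N z] would kill its leading coefficient. *)
pose N := size (theta z).
pose ys := [seq f ^+ N.+1 | f <- fs].
have szys : size ys = size fs by rewrite size_map.
have regys : regular_mod nonvanish_at J ys.
  by apply: regular_mod_pow => //; apply: loc_regular_seq_regular_mod.
have [B [c [i0 [lti0 ci0 Icz]]]] :=
  algebraic_dependence U1 UM hIz Ue hrho (leq_trans lts (eq_leq (esym szys))).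
have UC (a : K) : a != 0 -> nonvanish_at a%:A.
  move=> a0; rewrite /nonvanish_at /vanish_at mevalZ meval1 mulr1.
  exact/eqP.
have zys := relation_in_adjs U1 UM UC hJ regys lti0 ci0 Icz.
have hW := order_ge_uideal N.
have : order_ge N z.
  apply: (adjs_least hW) zys.
    move=> g [u [Uu Jg]]; apply: (uidealU hW Uu).
    suff th0 : theta (u * g) = 0 by move=> i _; rewrite th0 coef0.
    exact: (gen_ideal_least (ker_is_ideal theta) theta_js Jg).
  move=> y /mapP[f ffs ->]; rewrite exprS; apply: (uidealM hW).
  by apply: order_ge_pow; case: regfs => + _; apply.
move=> /(_ N.-1); rewrite /N.
case: (size _) (size_poly_eq0 (theta z)) (lead_coefE (theta z)).
  by move=> /esym; rewrite (negPf theta_z).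
move=> m _ <- /(_ (ltnSn _)) /eqP; rewrite lead_coef_eq0; exact/negP.
Qed.

End DepthBound.
End RationalPoint.

(** * Prime chains over binomial edge ideals *)

Lemma rmorph_mmap n (R S S' : comNzRingType) (g : {rmorphism S -> S'})
    (f : R -> S) (h : 'I_n -> S) (f' : R -> S') (h' : 'I_n -> S')
    (p : {mpoly R[n]}) :
  (forall c, g (f c) = f' c) -> (forall i, g (h i) = h' i) ->
  g (mmap f h p) = mmap f' h' p.
Proof.
move=> Ef Eh; rewrite /mmap rmorph_sum; apply: eq_bigr => m _.
rewrite rmorphM Ef /mmap1 rmorph_prod; congr (_ * _); apply: eq_bigr => i _.
by rewrite rmorphXn Eh.
Qed.

Section BinomialEdgeIdeal.
Variables (K : fieldType) (N : nat) (e : rel 'I_N).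
Hypothesis e_sym : ssrbool.symmetric e.
Local Notation S := {mpoly K[N + N]}.
Local Notation a := (@var_a K N).
Local Notation b := (@var_b K N).
Local Notation gens := (binomial_edge_gens K e).
Implicit Types (T : {set 'I_N}) (root : 'I_N -> 'I_N).

Definition edge_minor v w : S := a v * b w - a w * b v.

Lemma minor_gen v w : e v w -> gen_ideal gens (edge_minor v w).
Proof.
have [_ [_ JM]] := gen_ideal_is_ideal gens.
have lt_gen (v' w' : 'I_N) : (v' < w')%N -> e v' w' -> gen_ideal gens (edge_minor v' w').
  move=> ltvw evw; apply: gen_ideal_mem; apply/mapP; exists (v', w') => //.
  by rewrite mem_enum inE /= ltvw.
move=> evw; case: (ltngtP v w) => [ltvw|ltwv|/val_inj eqvw].
- exact: lt_gen.
- have -> : edge_minor v w = -1 * edge_minor w v by rewrite /edge_minor; ring.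
  by apply: JM; apply: lt_gen; rewrite // e_sym.
- by rewrite /edge_minor eqvw subrr; case: (gen_ideal_is_ideal gens).
Qed.

Definition on_pairs (R : Type) (h1 h2 : 'I_N -> R) (i : 'I_(N + N)) : R :=
  match split i with inl v => h1 v | inr v => h2 v end.

Lemma on_pairsl R (h1 h2 : 'I_N -> R) v : on_pairs h1 h2 (lshift N v) = h1 v.
Proof. by rewrite /on_pairs -[lshift N v]/(unsplit (inl v)) unsplitK. Qed.

Lemma on_pairsr R (h1 h2 : 'I_N -> R) v : on_pairs h1 h2 (rshift N v) = h2 v.
Proof. by rewrite /on_pairs -[rshift N v]/(unsplit (inr v)) unsplitK. Qed.

Lemma pairs_ind (Q : 'I_(N + N) -> Prop) :
  (forall v, Q (lshift N v)) -> (forall v, Q (rshift N v)) -> forall i, Q i.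
Proof. by move=> Ql Qr i; rewrite -(splitK i); case: (split i). Qed.

Section Substitution.
Variables (R : comNzRingType) (f : {rmorphism K -> R}) (h1 h2 : 'I_N -> R).
Local Notation subst := (mmap f (on_pairs h1 h2)).

Lemma subst_a v : subst (a v) = h1 v.
Proof. by rewrite /var_a mmapX mmap1U on_pairsl. Qed.

Lemma subst_b v : subst (b v) = h2 v.
Proof. by rewrite /var_b mmapX mmap1U on_pairsr. Qed.

Lemma subst_minor v w : subst (edge_minor v w) = h1 v * h2 w - h1 w * h2 v.
Proof. by rewrite rmorphB !rmorphM /= !subst_a !subst_b. Qed.

Lemma subst_gens_eq0 :
  (forall v w, e v w -> h1 v * h2 w = h1 w * h2 v) ->
  forall f, f \in gens -> subst f = 0.
Proof.
move=> h g /mapP[[v w]]; rewrite mem_enum inE /= => /andP[_ evw] ->.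
by rewrite -[_ - _]/(edge_minor v w) subst_minor h ?subrr.
Qed.

End Substitution.

(* [root] is constant on the components of the graph minus [T]; it may take the
   same value on several of them. *)
Definition separated T root : Prop :=
  (forall w, w \notin T -> root w \notin T /\ root (root w) = root w) /\
  (forall v w, v \notin T -> w \notin T -> e v w -> root v = root w).

Definition comp_roots T root := [set w | (w \notin T) && (root w == w)].

Definition comp_dim T root := (#|~: T| + #|comp_roots T root|)%N.

(** Parameters of the component: the slot of [b r] at a root holds the ratio b/a common to its
    class, and the [a w] are free. Ratios come first, so the chain specializes a ratio while [a r]
    is still a variable. *)
Definition comp_vars T root : seq 'I_(N + N) :=
  [seq rshift N r | r <- enum (comp_roots T root)] ++
  [seq lshift N w | w <- enum (~: T)].

Lemma size_comp_vars T root : size (comp_vars T root) = comp_dim T root.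
Proof. by rewrite size_cat !size_map -!cardE addnC. Qed.

Lemma lshift_comp_vars T root w :
  (lshift N w \in comp_vars T root) = (w \notin T).
Proof.
rewrite mem_cat (mem_map (@lshift_inj _ _)) mem_enum inE.
apply: orb_idl => /mapP[r _ /eqP].
by rewrite eq_lrshift.
Qed.

Lemma rshift_comp_vars T root r :
  (rshift N r \in comp_vars T root) = (r \in comp_roots T root).
Proof.
rewrite mem_cat (mem_map (@rshift_inj _ _)) mem_enum.
apply: orb_idr => /mapP[w _ /eqP].
by rewrite eq_rlshift.
Qed.

Lemma comp_vars_uniq T root : uniq (comp_vars T root).
Proof.
rewrite cat_uniq (map_inj_uniq (@rshift_inj _ _)) (map_inj_uniq (@lshift_inj _ _)).
rewrite !enum_uniq andbT /=; apply/hasPn => x /mapP[w _ ->].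
by apply/mapP => -[r _ /eqP]; rewrite eq_lrshift.
Qed.

Section Chain.
Variables (T : {set 'I_N}) (root : 'I_N -> 'I_N) (alpha : 'I_N -> K).
Hypotheses (sepT : separated T root) (alphaT : forall v, v \in T -> alpha v = 0).
Local Notation pt := (on_pairs alpha (fun=> 0)).

Let k (X : seq 'I_(N + N)) i : S := if i \in X then (pt i)%:MP else 'X_i.

(** The parametrization with the parameters in [X] specialized to their values at [pt]: [b w] is the
    ratio at [root w] times [a w], and both are 0 on [T]. *)
Let psi X : {rmorphism S -> S} := mmap (@mpolyC _ K)
  (on_pairs (fun w => if w \in T then 0 else k X (lshift N w))
     (fun w => if w \in T then 0
               else k X (rshift N (root w)) * k X (lshift N w))).

Let psi_a X w : psi X (a w) = if w \in T then 0 else k X (lshift N w).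
Proof. exact: subst_a. Qed.

Let psi_b X w : psi X (b w) =
  if w \in T then 0 else k X (rshift N (root w)) * k X (lshift N w).
Proof. exact: subst_b. Qed.

Let psi_aB X w c :
  psi X (a w - c%:MP) = (if w \in T then 0 else k X (lshift N w)) - c%:MP.
Proof. by rewrite rmorphB psi_a /= mmapC. Qed.

(** [psi Y] is [psi X] followed by specializing the parameters in [Y]. *)
Let psi_sub (X Y : seq 'I_(N + N)) f : {subset X <= Y} -> psi X f = 0 -> psi Y f = 0.
Proof.
move=> sXY fX.
suff <- : mmap (@mpolyC _ K) (k Y) (psi X f) = psi Y f by rewrite fX rmorph0.
have kk i : mmap (@mpolyC _ K) (k Y) (k X i) = k Y i.
  rewrite {2}/k; case: ifP => iX; last by rewrite mmapX mmap1U.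
  by rewrite /k sXY ?mmapC //; exact: mmapC.
apply: rmorph_mmap => [c|]; first exact: mmapC.
apply: pairs_ind => v; rewrite ?on_pairsl ?on_pairsr;
  by case: ifP => _; rewrite ?rmorph0 ?rmorphM /= ?kk.
Qed.

Let psi_all f : psi (comp_vars T root) f = (f.@[pt])%:MP.
Proof.
apply/esym; apply: rmorph_mmap => //.
have [rT _] := sepT.
apply: pairs_ind => v; rewrite ?on_pairsl ?on_pairsr.
  by rewrite /k lshift_comp_vars on_pairsl; case: (boolP (v \in T)) => //= /alphaT ->.
case: ifPn => // vT; have [rvT rrv] := rT v vT.
by rewrite /k rshift_comp_vars inE rvT rrv eqxx /= on_pairsr mul0r.
Qed.

Let X_sub_neq0 (i : 'I_(N + N)) (c : K) : 'X_i - c%:MP != 0 :> S.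
Proof.
apply/eqP => /(congr1 (mcoeff U_(i))); rewrite mcoeffB mcoeffX eqxx mcoeffC mcoeff0.
rewrite [_ == 0%MM]negbTE ?mulr0 ?subr0; first by apply/eqP/oner_neq0.
by rewrite -mdeg_eq0 mdeg1.
Qed.

Let X_neq0 (i : 'I_(N + N)) : 'X_i != 0 :> S.
Proof. by have := X_sub_neq0 i 0; rewrite mpolyC0 subr0. Qed.

(** The primes are the kernels of [psi] as the parameters are specialized one at a time; with all of
    them specialized, [psi] is evaluation at [pt]. *)
Lemma comp_chain :
  exists Q, prime_chain_to gens (vanish_at pt) Q (comp_dim T root).
Proof.
set L := comp_vars T root.
have [rT sep] := sepT.
exists (fun i f => psi (take i L) f = 0); split; [|split; [|split]].
- by move=> i _; apply: ker_is_prime.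
- move=> i _ f; apply: (gen_ideal_least (ker_is_ideal (psi (take i L)))).
  apply: subst_gens_eq0 => v w evw.
  case: ifPn => vT; case: ifPn => wT; rewrite ?mulr0 ?mul0r //.
  by rewrite (sep v w) //; ring.
- move=> i; rewrite -size_comp_vars -/L => lti; split.
    move=> f; apply: psi_sub => x.
    rewrite (take_nth (tnth (in_tuple L) (Ordinal lti))) //.
    by rewrite mem_rcons inE orbC => ->.
  set x := tnth (in_tuple L) (Ordinal lti).
  have Ex : x = nth x L i by rewrite {1}/x (tnth_nth x).
  have xL : x \in L by rewrite Ex mem_nth.
  have tk : take i.+1 L = rcons (take i L) x by rewrite (take_nth x) // -Ex.
  have xtk : x \notin take i L.
    by have := take_uniq i.+1 (comp_vars_uniq T root); rewrite -/L tk rcons_uniq => /andP[].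
  have xtk1 : x \in take i.+1 L by rewrite tk mem_rcons mem_head.
  have lr : (exists2 w, x = lshift N w & w \notin T) \/
      (exists2 r, x = rshift N r & r \in comp_roots T root /\ lshift N r \notin take i L).
    have [lti'|lei] := ltnP i (size [seq rshift N r | r <- enum (comp_roots T root)]).
      right; have : x \in [seq rshift N r | r <- enum (comp_roots T root)].
        by rewrite Ex /L /comp_vars nth_cat lti' mem_nth.
      move=> /mapP[r rr xr]; exists r => //; split; first by rewrite mem_enum in rr.
      rewrite /L /comp_vars takel_cat 1?ltnW //.
      apply/negP => /mem_take /mapP[r' _ /eqP].
      by rewrite eq_lrshift.
    left; have : x \in [seq lshift N w | w <- enum (~: T)].
      rewrite Ex /L /comp_vars nth_cat ltnNge lei mem_nth //.
      by rewrite ltn_subLR // -size_cat.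
    by move=> /mapP[w]; rewrite mem_enum inE => wT ->; exists w.
  (* Strictness is witnessed by [a w] minus its value for a free variable, and by [b r] for a
     ratio. *)
  case: lr => [[w xw wT]|[r xr [rr artk]]];
    [rewrite xw in xtk xtk1 | rewrite xr in xtk xtk1].
    exists (a w - (alpha w)%:MP); split.
      by rewrite psi_aB (negPf wT) /k xtk1 on_pairsl subrr.
    by rewrite psi_aB (negPf wT) /k (negPf xtk); apply/eqP; apply: X_sub_neq0.
  move: rr; rewrite inE => /andP[rT' /eqP rr].
  exists (b r); split.
    by rewrite psi_b (negPf rT') rr /k xtk1 on_pairsr mpolyC0 mul0r.
  rewrite psi_b (negPf rT') rr /k (negPf xtk) (negPf artk).
  by apply/eqP; apply: mulf_neq0; apply: X_neq0.
- move=> f; rewrite -size_comp_vars take_size psi_all.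
  split=> [|->]; last by rewrite mpolyC0.
  by move=> /(congr1 (mcoeff 0%MM)); rewrite mcoeffC eqxx mulr1 mcoeff0.
Qed.

End Chain.
End BinomialEdgeIdeal.

(** * Cut sets *)

Section CutSets.
Variables (K : fieldType) (N : nat) (e : rel 'I_N).
Hypothesis e_sym : ssrbool.symmetric e.
Local Notation S := {mpoly K[N + N]}.
Local Notation a := (@var_a K N).
Local Notation b := (@var_b K N).
Local Notation gens := (binomial_edge_gens K e).
Local Notation minor := (@edge_minor K N).

Definition cut_set (T : {set 'I_N}) (root : 'I_N -> 'I_N) : Prop :=
  [/\ separated e T root,
      forall w, w \notin T ->
        connect [rel x y | [&& x \notin T, y \notin T & e x y]] (root w) w
    & forall v, v \in T -> exists w w',
        [/\ w \notin T, w' \notin T, e v w, e v w' & root w != root w']].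

Variables (T : {set 'I_N}) (root : 'I_N -> 'I_N).
Hypothesis cutT : cut_set T root.

Let rootP w (wT : w \notin T) : root w \notin T /\ root (root w) = root w.
Proof. by case: cutT => -[+ _] _ _; apply. Qed.

Let outer : S := \prod_(w | w \notin T) a w.

Let J := gen_ideal gens.

Let JM f g : J g -> J (f * g).
Proof. by have [_ [_ h]] := gen_ideal_is_ideal gens; apply: h. Qed.

Let JE f g : J f -> g = f -> J g.
Proof. by move=> Jf ->. Qed.

Let JD f g : J f -> J g -> J (f + g).
Proof. by have [_ [h _]] := gen_ideal_is_ideal gens; apply: h. Qed.

(** The step along an edge from v to w is the syzygy a_v [u,w] = a_u [v,w] + a_w [u,v] between
    minors; it costs one factor [a v], supplied by [outer]. *)
Let path_minor u p : u \notin T ->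
  path [rel x y | [&& x \notin T, y \notin T & e x y]] u p ->
  exists k, J (outer ^+ k * minor u (last u p)).
Proof.
move=> uT; elim/last_ind: p => [|p w IH] /=.
  move=> _; exists 0%N; rewrite /edge_minor subrr mulr0.
  by case: (gen_ideal_is_ideal gens).
rewrite rcons_path last_rcons => /andP[/IH[k Jk]].
set v := last u p in Jk *; move=> /and3P[vT wT evw].
exists k.+1; rewrite exprSr {2}/outer (bigD1 v) //=; set q := \prod_(_ | _) _.
have -> : outer ^+ k * (a v * q) * minor u w =
  outer ^+ k * q * a u * minor v w + q * a w * (outer ^+ k * minor u v).
  by rewrite /edge_minor; ring.
by apply: JD; apply: JM => //; apply: minor_gen.
Qed.

Let root_minor : exists k, forall w, w \notin T -> J (outer ^+ k * minor (root w) w).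
Proof.
have [k hk] : exists k : 'I_N -> nat, forall w, w \notin T ->
    J (outer ^+ k w * minor (root w) w).
  apply: (@fin_all_exists _ (fun=> nat)
    (fun w k => w \notin T -> J (outer ^+ k * minor (root w) w))) => w.
  have [wT|wT] := boolP (w \in T); first by exists 0%N.
  have [_ conn _] := cutT; have /connectP[p pp Ew] := conn w wT.
  by have [k] := path_minor (proj1 (rootP wT)) pp; rewrite -Ew => Jk; exists k.
(* The sum of the exponents serves all [w] at once. *)
exists (\sum_w k w)%N => w wT.
by rewrite (bigD1 w) //= exprD mulrC mulrA [minor _ _ * _]mulrC mulrC; apply/JM/hk.
Qed.

(** Three-term relations among 2x2 minors; thus a vertex of [T] is annihilated by a minor joining
    two of its neighbours. *)
Let cut_minor v w w' : e v w -> e v w' ->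
  J (a v * minor w w') /\ J (b v * minor w w').
Proof.
move=> evw evw'; split.
  have -> : a v * minor w w' = a w * minor v w' + (- a w') * minor v w.
    by rewrite /edge_minor; ring.
  by apply: JD; apply: JM; apply: minor_gen.
have -> : b v * minor w w' = b w * minor v w' + (- b w') * minor v w.
  by rewrite /edge_minor; ring.
by apply: JD; apply: JM; apply: minor_gen.
Qed.

(** A point at which the [a r] at the roots, the denominators below, are invertible. *)
Local Notation pt := (on_pairs (fun w => (w \in comp_roots T root)%:R : K) (fun=> 0)).
Local Notation E := {mpoly K[N]}.

(** Arcs passing through [pt] at X = 0. The ratio b/a is X times an independent variable for each
    component, so minors vanish within a component but not between two of them. *)
Let ta (w : 'I_N) : {poly E} :=
  if w \in T then 0 else if root w == w then 1 else 'X.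
Let tb (w : 'I_N) : {poly E} :=
  if w \in T then 0 else ('X_(root w))%:P * 'X * ta w.
Let theta : {rmorphism S -> {poly E}} :=
  mmap (polyC \o @mpolyC N K) (on_pairs ta tb).

Lemma cut_set_depth_bound fs :
  loc_regular_seq gens (vanish_at pt) fs -> (size fs <= comp_dim T root)%N.
Proof.
have [k0 hk0] := root_minor.
have [_ _ cutP] := cutT.
have [nb hnb] : exists nb : 'I_N -> 'I_N * 'I_N, forall v, v \in T ->
    [/\ (nb v).1 \notin T, (nb v).2 \notin T, e v (nb v).1, e v (nb v).2
      & root (nb v).1 != root (nb v).2].
  apply: (@fin_all_exists _ (fun=> ('I_N * 'I_N)%type)
    (fun v p => v \in T -> [/\ p.1 \notin T, p.2 \notin T, e v p.1, e v p.2
      & root p.1 != root p.2])) => v.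
  have [vT|vT] := boolP (v \in T); last by exists (v, v).
  by have [w [w' ?]] := cutP v vT; exists (w, w').
(* The power of [outer] makes the minors within a component annihilate [z]; the other factors make
   [a v] and [b v] annihilate it for [v] in [T]. *)
pose z : S := outer ^+ k0 * \prod_(v in T) minor (nb v).1 (nb v).2.
have Ez v (vT : v \in T) : z = outer ^+ k0 *
    (minor (nb v).1 (nb v).2 * \prod_(i in T | i != v) minor (nb i).1 (nb i).2).
  by rewrite /z (bigD1 v).
set L := comp_vars T root.
pose x (j : 'I_(size L)) : S := 'X_(tnth (in_tuple L) j).
pose im f := exists g, f = mmap (@mpolyC _ K) x g.
have imM f g : im f -> im g -> im (f * g).
  by move=> [f' ->] [g' ->]; exists (f' * g'); rewrite rmorphM.
have im_prod (I : finType) (Q : pred I) (F : I -> S) :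
    (forall i, Q i -> im (F i)) -> im (\prod_(i | Q i) F i).
  move=> hF; apply: (big_ind im) => //.
  by exists 1; rewrite rmorph1.
have imX i : i \in L -> im 'X_i.
  move=> iL; have lti : (index i L < size L)%N by rewrite index_mem.
  exists 'X_(Ordinal lti); rewrite mmapX mmap1U /x (tnth_nth i) /=.
  by rewrite nth_index.
have im_a w : w \notin T -> im (a w) by move=> wT; apply: imX; rewrite lshift_comp_vars.
have im_b r : r \in comp_roots T root -> im (b r).
  by move=> rr; apply: imX; rewrite rshift_comp_vars.
have root_roots w : w \notin T -> root w \in comp_roots T root.
  by move=> wT; have [rT rr] := rootP wT; rewrite inE rT rr eqxx.
have roots_notT r : r \in comp_roots T root -> r \notin T by rewrite inE => /andP[].
have [e' He] : im (\prod_(r in comp_roots T root) a r).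
  by apply: im_prod => r /roots_notT; apply: im_a.
have colon i : exists g, J ((\prod_(r in comp_roots T root) a r * 'X_i
    - mmap (@mpolyC _ K) x g) * z).
  move: i; apply: pairs_ind => v; have [vT|vT] := boolP (v \in T).
  - exists 0; rewrite rmorph0 subr0 (Ez v vT).
    have [_ _ e1 e2 _] := hnb v vT; have [Ja _] := cut_minor e1 e2.
    apply: JE (JM (\prod_(r in comp_roots T root) a r * outer ^+ k0 *
      \prod_(i in T | i != v) minor (nb i).1 (nb i).2) Ja) _.
    by rewrite /var_a; ring.
  - have [g Hg] : im (\prod_(r in comp_roots T root) a r * a v).
      by apply: (imM); [exists e' | apply: im_a].
    exists g; rewrite -Hg subrr mul0r; by case: (gen_ideal_is_ideal gens).
  - exists 0; rewrite rmorph0 subr0 (Ez v vT).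
    have [_ _ e1 e2 _] := hnb v vT; have [_ Jb] := cut_minor e1 e2.
    apply: JE (JM (\prod_(r in comp_roots T root) a r * outer ^+ k0 *
      \prod_(i in T | i != v) minor (nb i).1 (nb i).2) Jb) _.
    by rewrite /var_b; ring.
  (* Here [b v] is replaced by [b (root v) * a v] over [a (root v)]; the error is a multiple of the
     minor of [root v] and [v]. *)
  - rewrite (bigD1 (root v)) ?root_roots //=; set q := \prod_(_ | _) _.
    have [g Hg] : im (q * b (root v) * a v).
      apply: (imM); last exact: im_a.
      apply: (imM); last by apply: im_b; apply: root_roots.
      by apply: im_prod => r /andP[/roots_notT rT _]; apply: im_a.
    exists g; rewrite -Hg.
    apply: JE (JM (q * \prod_(i in T) minor (nb i).1 (nb i).2) (hk0 v vT)) _.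
    by rewrite /z /edge_minor /var_b; ring.
have [rho hrho] := fin_all_exists colon.
rewrite -size_comp_vars -/L.
apply: (@depth_bound K _ pt _ theta _ _ _ x e' rho z).
- move=> f fpt.
  suff Eth : horner_eval 0 (theta f) = (f.@[pt])%:MP.
    by rewrite -horner_coef0 -[_.[0]]/(horner_eval 0 _) Eth fpt mpolyC0.
  rewrite /theta.
  rewrite [RHS](rmorph_mmap (g := @mpolyC _ K) (f' := @mpolyC N K)
    (h' := fun i => (pt i)%:MP)) //.
  apply: rmorph_mmap => [c|]; first exact: hornerC.
  apply: pairs_ind => v; rewrite /= ?on_pairsl ?on_pairsr /horner_eval /ta /tb ?inE.
    by case: (v \in T); case: (root v == v); rewrite ?hornerC ?hornerX ?mpolyC0 ?mpolyC1.
  by case: (v \in T); rewrite ?hornerC // !hornerM hornerX mulr0 mul0r mpolyC0.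
- apply: subst_gens_eq0 => v w evw.
  rewrite /tb; case: ifPn => vT; case: ifPn => wT; rewrite ?mulr0 ?mul0r //;
    rewrite /ta ?(negPf vT) ?(negPf wT) ?vT ?wT ?mulr0 ?mul0r //.
  have [[_ sep] _ _] := cutT; rewrite (sep v w) //; ring.
- have tha v : theta (a v) = ta v by apply: subst_a.
  have thb v : theta (b v) = tb v by apply: subst_b.
  have ta_neq0 w : w \notin T -> ta w != 0.
    move=> wT; rewrite /ta (negPf wT); case: ifP => _; first exact: oner_neq0.
    by rewrite polyX_eq0.
  rewrite rmorphM rmorphXn !rmorph_prod mulf_neq0 ?expf_neq0 //=.
    by apply/prodf_neq0 => w wT; rewrite tha ta_neq0.
  apply/prodf_neq0 => v vT; have [n1 n2 _ _ rne] := hnb v vT.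
  rewrite rmorphB !rmorphM !tha !thb /tb (negPf n1) (negPf n2).
  move: (nb v).1 (nb v).2 n1 n2 rne => w w' n1 n2 rne.
  have -> : ta w * (('X_(root w'))%:P * 'X * ta w')
    - ta w' * (('X_(root w))%:P * 'X * ta w)
    = ('X_(root w') - 'X_(root w))%:P * ('X * ta w * ta w') :> {poly E}.
    by rewrite polyCB; ring.
  rewrite !mulf_neq0 ?ta_neq0 ?polyX_eq0 // polyC_eq0.
  apply/eqP => /(congr1 (mcoeff U_(root w))) /eqP.
  rewrite mcoeffB !mcoeffX eqxx mcoeff0 eq_mnm1 [root w' == _]eq_sym (negPf rne) sub0r.
  by rewrite oppr_eq0 oner_eq0.
- rewrite -He /nonvanish_at /vanish_at rmorph_prod big1 /=; first exact/eqP/oner_neq0.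
  by move=> r rr; rewrite /var_a mevalXU on_pairsl rr.
- move=> i; exists 1; split; first exact: nonvanish_at1.
  by rewrite mul1r -He; apply: hrho.
Qed.

(** At the point attached to [T], depth equals dimension. Disjointness puts this point on the
    component of [T'], whose chain bounds the dimension from below. *)
Lemma cut_set_max_comp_dim (T' : {set 'I_N}) (root' : 'I_N -> 'I_N) :
  CohenMacaulay_quot gens -> separated e T' root' ->
  [disjoint comp_roots T root & T'] -> (comp_dim T' root' <= comp_dim T root)%N.
Proof.
move=> CM sepT' disj.
have [|Q chainQ] :=
  @comp_chain K N e T' root' (fun w => (w \in comp_roots T root)%:R) sepT'.
  by move=> v vT'; rewrite (disjointFl disj vT').
have sJP f : gen_ideal gens f -> vanish_at pt f.
  by case: chainQ => _ [sJQ [_ QP]] Jf; apply/QP/sJQ.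
have [r [[fs [<- regfs]] [_ [_ hdim]]]] := CM _ (vanish_at_maximal pt) sJP.
exact: leq_trans (hdim _ _ chainQ) (cut_set_depth_bound regfs).
Qed.

End CutSets.

(** * Incidence graphs *)

Section IncidenceGraph.
Variables (m k : nat) (M : 'I_m -> 'I_k -> bool).

Definition incidence_rel : rel 'I_(m + k) := fun x y =>
  match split x, split y with
  | inl p, inr j => M p j
  | inr j, inl p => M p j
  | _, _ => false
  end.

Let pnt (p : 'I_m) : 'I_(m + k) := lshift k p.
Let crv (j : 'I_k) : 'I_(m + k) := rshift m j.

Let split_pnt p : split (pnt p) = inl p.
Proof. exact: (unsplitK (inl p)). Qed.

Let split_crv j : split (crv j) = inr j.
Proof. exact: (unsplitK (inr j)). Qed.

Let vertexP x : (exists p, x = pnt p) \/ (exists j, x = crv j).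
Proof.
by rewrite -(splitK x); case: (split x) => [p|j]; [left; exists p | right; exists j].
Qed.

Let pnt_eq p q : (pnt p == pnt q) = (p == q).
Proof. exact: eq_lshift. Qed.

Let crv_eq i j : (crv i == crv j) = (i == j).
Proof. exact: eq_rshift. Qed.

Let pnt_crv p j : (pnt p == crv j) = false.
Proof. exact: eq_lrshift. Qed.

Let crv_pnt p j : (crv j == pnt p) = false.
Proof. exact: eq_rlshift. Qed.

Let rel_pc p j : incidence_rel (pnt p) (crv j) = M p j.
Proof. by rewrite /incidence_rel split_pnt split_crv. Qed.

Let rel_cp p j : incidence_rel (crv j) (pnt p) = M p j.
Proof. by rewrite /incidence_rel split_pnt split_crv. Qed.

Let rel_pp p q : incidence_rel (pnt p) (pnt q) = false.
Proof. by rewrite /incidence_rel !split_pnt. Qed.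

Let rel_cc i j : incidence_rel (crv i) (crv j) = false.
Proof. by rewrite /incidence_rel !split_crv. Qed.

Let shiftE := (pnt_eq, crv_eq, pnt_crv, crv_pnt, rel_pc, rel_cp, rel_pp, rel_cc).

Lemma incidence_rel_sym : ssrbool.symmetric incidence_rel.
Proof. by move=> x y; rewrite /incidence_rel; case: (split x); case: (split y). Qed.

Variable K : fieldType.
Local Notation gens := (binomial_edge_gens K incidence_rel).
Hypotheses (k_ge3 : (3 <= k)%N)
  (two_curves : forall p, exists i j, [/\ i != j, M p i & M p j])
  (meet : forall i j, i != j -> exists p, M p i && M p j)
  (CM : CohenMacaulay_quot gens).

Let small_curve j (ltj : (j < 3)%N) : 'I_k := Ordinal (leq_trans ltj k_ge3).

Let curve_point j : exists p, M p j.
Proof.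
have [i nij] : exists i, i != j.
  have [->|] := eqVneq j (small_curve (isT : 0 < 3)%N); last first.
    by rewrite eq_sym; exists (small_curve (isT : 0 < 3)%N).
  by exists (small_curve (isT : 1 < 3)%N).
by have [p /andP[_ Mp]] := meet nij; exists p.
Qed.

Let comp_dim_trivial x0 : comp_dim set0 (fun=> x0 : 'I_(m + k)) = (m + k).+1.
Proof.
rewrite /comp_dim setC0 cardsT card_ord -addn1; congr addn.
rewrite (_ : comp_roots _ _ = [set x0]) ?cards1 //.
by apply/setP => w; rewrite !inE eq_sym.
Qed.

Let separated_trivial x0 : separated incidence_rel set0 (fun=> x0).
Proof. by split=> // w; rewrite !inE. Qed.

Let disjoint0 (A : {set 'I_(m + k)}) : [disjoint A & set0].
Proof. by rewrite -setI_eq0 setI0. Qed.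

Let points_lt_curves : (m < k)%N.
Proof.
rewrite ltnNge; apply/negP => lekm.
(* With the points deleted each curve is a component by itself, so [root] is the identity and m + k
   + 1 <= 2k. *)
pose T := [set x : 'I_(m + k) | if split x is inl _ then true else false].
have Tp p : pnt p \in T by rewrite inE split_pnt.
have Tc j : crv j \in T = false by rewrite inE split_crv.
have cut : cut_set incidence_rel T id.
  split=> [|w _|v].
  - split=> // v w.
    by case: (vertexP v) => -[? ->]; case: (vertexP w) => -[? ->];
      rewrite ?Tp ?Tc ?shiftE.
  - exact: connect0.
  - case: (vertexP v) => -[x ->]; rewrite ?Tc // => _.
    have [i [j [nij Mi Mj]]] := two_curves x.
    by exists (crv i), (crv j); rewrite !Tc !shiftE.
have := cut_set_max_comp_dim incidence_rel_sym cut CM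
  (separated_trivial (crv (small_curve (isT : 0 < 3)%N))) (disjoint0 _).
rewrite comp_dim_trivial /comp_dim.
have leC : (#|~: T| <= k)%N.
  rewrite -[X in (_ <= X)%N]card_ord -(card_imset _ (@rshift_inj m k)).
  apply/subset_leq_card/subsetP => x; rewrite in_setC.
  by case: (vertexP x) => -[y ->]; rewrite ?Tp // => _; apply: imset_f.
have : (#|comp_roots T id| <= #|~: T|)%N.
  by apply/subset_leq_card/subsetP => x; rewrite !in_set => /andP[].
move=> leR leD; have := leq_trans leD (leq_add leC (leq_trans leR leC)).
lia.
Qed.

Definition leaf_curve j := (#|[set p | M p j]| <= 1)%N.

Let leaf_eq j p q : leaf_curve j -> M p j -> M q j -> p = q.
Proof. by move=> /card_le1_eqP h Mp Mq; apply: h; rewrite inE. Qed.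

Let two_leaves : (1 < #|[set j | leaf_curve j]|)%N.
Proof.
rewrite ltnNge; apply/negP => le1.
(* What remains is a union of stars centred at the points: at most m + 1 vertices and m roots, so m
   + k + 1 <= 2m + 1, against m < k. *)
pose T := [set x : 'I_(m + k) | if split x is inr j then ~~ leaf_curve j else false].
have Tp p : pnt p \in T = false by rewrite inE split_pnt.
have Tc j : crv j \in T = ~~ leaf_curve j by rewrite inE split_crv.
(* On a leaf, [pick] finds its only point; the default after a failed [pick] never occurs, by
   [curve_point]. *)
pose root (x : 'I_(m + k)) := if split x is inr j then
  if [pick p | M p j] is Some p then pnt p else x else x.
have rootp p : root (pnt p) = pnt p by rewrite /root split_pnt.
have rootc j : exists2 p, root (crv j) = pnt p & M p j.
  rewrite /root split_crv; case: pickP => [p Mp|M0]; first by exists p.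
  by have [p] := curve_point j; rewrite M0.
have root_leaf p j : leaf_curve j -> M p j -> root (crv j) = pnt p.
  by move=> lj Mp; have [q -> Mq] := rootc j; rewrite (leaf_eq lj Mp Mq).
have cut : cut_set incidence_rel T root.
  split=> [|w|v].
  - split=> [w|v w].
      case: (vertexP w) => -[x ->] wT; first by rewrite rootp Tp.
      by have [p -> _] := rootc x; rewrite rootp Tp.
    case: (vertexP v) => -[x ->]; case: (vertexP w) => -[y ->];
      rewrite ?Tp ?Tc ?negbK ?shiftE // => h1 h2 h3.
      by rewrite rootp (root_leaf x).
    by rewrite rootp (root_leaf y).
  - case: (vertexP w) => -[x ->] wT; first by rewrite rootp connect0.
    have [p -> Mp] := rootc x; apply: connect1.
    by rewrite /= Tp wT shiftE.
  - case: (vertexP v) => -[x ->]; rewrite ?Tp // Tc -ltnNge => /card_gt1P[p [q]].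
    rewrite !inE => -[Mp Mq npq].
    by exists (pnt p), (pnt q); rewrite !Tp !rootp !shiftE.
have := cut_set_max_comp_dim incidence_rel_sym cut CM
  (separated_trivial (crv (small_curve (isT : 0 < 3)%N))) (disjoint0 _).
rewrite comp_dim_trivial /comp_dim.
have cardp : #|[set pnt p | p in 'I_m]| = m.
  by rewrite card_imset ?card_ord //; apply: lshift_inj.
have : (#|~: T| <= m + 1)%N.
  apply: (@leq_trans #|[set pnt p | p in 'I_m] :|:
      [set crv j | j in [set j | leaf_curve j]]|).
    apply/subset_leq_card/subsetP => x; rewrite in_setC in_setU.
    case: (vertexP x) => -[y ->] yT; first by rewrite imset_f.
    by rewrite orbC imset_f // inE -[leaf_curve y]negbK -Tc.
  apply: leq_trans (leq_card_setU _ _).1 _; rewrite cardp leq_add2l.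
  exact: leq_trans (leq_imset_card _ _) le1.
have : (#|comp_roots T root| <= m)%N.
  rewrite -[X in (_ <= X)%N]cardp; apply/subset_leq_card/subsetP => x.
  rewrite inE => /andP[_ /eqP <-]; case: (vertexP x) => -[y ->].
    by rewrite rootp imset_f.
  by have [p -> _] := rootc y; rewrite imset_f.
move=> leR leC leD; have := leq_trans leD (leq_add leC leR).
have := points_lt_curves; lia.
Qed.

Lemma incidence_rel_not_CM : False.
Proof.
have /card_gt1P[j0 [j1]] := two_leaves; rewrite !inE => -[leaf0 leaf1 n01].
have [p /andP[Mp0 Mp1]] := meet n01.
(* Every curve meets [j0], whose only point is [p]. *)
have Mp j : M p j.
  have [<-//|n0j] := eqVneq j0 j; have [q /andP[Mq0 Mqj]] := meet n0j.
  by rewrite (leaf_eq leaf0 Mp0 Mq0).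
have [j2 /andP[n20 n21]] : exists j2, (j2 != j0) && (j2 != j1).
  have : (0 < #|~: [set j0; j1]|)%N by rewrite cardsCs setCK card_ord cards2 n01 subn_gt0.
  by case/card_gt0P => j2; rewrite !inE negb_or => h; exists j2.
have cut : cut_set incidence_rel set0 (fun=> crv j0).
  split=> [|w _|v]; [exact: separated_trivial | | by rewrite inE].
  set e := (X in connect X _ _).
  have cp : connect e (crv j0) (pnt p).
    by apply: connect1; rewrite /e /= !inE shiftE.
  have cc j : connect e (crv j0) (crv j).
    by apply: connect_trans cp _; apply: connect1; rewrite /e /= !inE shiftE ?Mp.
  case: (vertexP w) => -[x ->] //.
  have [i [_ [_ Mi _]]] := two_curves x.
  by apply: connect_trans (cc i) _; apply: connect1; rewrite /e /= !inE shiftE.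
pose T := [set pnt p].
(* Without [p] the leaves [j0] and [j1] are isolated; all else is labelled [j2]. Three roots give
   dimension at least m + k - 1 + 3. *)
pose root x := if (x == crv j0) || (x == crv j1) then x else crv j2.
have sep : separated incidence_rel T root.
  have rootT v w : incidence_rel v w -> v \notin T -> w \notin T ->
      (v == crv j0) || (v == crv j1) = false.
    case: (vertexP w) => -[y ->] evw vT; rewrite !inE ?shiftE => wT.
      apply/norP; split; apply: contraNN wT => /eqP vj; move: evw;
        rewrite vj shiftE => Mj; apply/eqP.
        exact: leaf_eq leaf0 Mj Mp0.
      exact: leaf_eq leaf1 Mj Mp1.
    by case: (vertexP v) evw vT => -[x ->]; rewrite ?shiftE.
  split=> [w wT|v w vT wT evw].
    rewrite /root !inE; case: ifP => [h|_]; last first.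
      by rewrite !shiftE (negPf n20) (negPf n21).
    by rewrite h; split=> //; case/orP: h => /eqP ->; rewrite shiftE.
  rewrite /root (rootT v w) // (rootT w v) //.
  by rewrite incidence_rel_sym.
have disj : [disjoint comp_roots set0 (fun=> crv j0) & T].
  rewrite -setI_eq0; apply/eqP/setP => w; rewrite !inE.
  by apply/negP => /andP[/eqP <-]; rewrite shiftE.
have := cut_set_max_comp_dim incidence_rel_sym cut CM sep disj.
rewrite comp_dim_trivial /comp_dim cardsCs setCK card_ord cards1.
have : (#|[set crv j0; crv j1; crv j2]| <= #|comp_roots T root|)%N.
  apply/subset_leq_card/subsetP => x; rewrite !inE => /orP[/orP[]|] /eqP ->;
    by rewrite /root !shiftE ?eqxx ?orbT ?(negPf n20) ?(negPf n21) /= ?eqxx.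
rewrite -setUA cardsU1 cards2 !inE !shiftE (negPf n01) eq_sym (negPf n20).
rewrite [j1 == _]eq_sym n21 /= => le3 leD.
have := leq_trans (leq_add (leqnn _) le3) leD; lia.
Qed.

End IncidenceGraph.

(** * Plane curves *)

Lemma meval_dhomog_scale (R : comNzRingType) n d (F : {mpoly R[n]}) (c : R)
    (v w : 'I_n -> R) :
  F \is d.-homog -> (forall l, v l = c * w l) -> F.@[v] = c ^+ d * F.@[w].
Proof.
move=> /dhomogP homF vE; rewrite !mevalE mulr_sumr !big_seq; apply: eq_bigr => m ms.
have <- : mdeg m = d := homF m ms.
rewrite mdegE expr_sum mulrCA -big_split /=; congr (_ * _); apply: eq_bigr => i _.
by rewrite vE exprMn.
Qed.

Section PlaneCurvesMeet.
Variable C : closedFieldType.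

Definition point3 (x y z : C) (l : 'I_3) : C := [:: x; y; z]`_l.

(* [F] as a polynomial in the third variable, over the polynomials in the first
   variable, over the polynomials in the second. *)
Definition poly_z (F : {mpoly C[3]}) : {poly {poly {poly C}}} :=
  mmap (polyC \o polyC \o @polyC C)
    (fun l : 'I_3 => [:: 'X%:P; 'X%:P%:P; 'X]`_l) F.

Definition eval_xy (x y : C) : {rmorphism {poly {poly C}} -> C} :=
  horner_eval y \o horner_eval x%:P.

Lemma poly_z_eval F x y z :
  (map_poly (eval_xy x y) (poly_z F)).[z] = F.@[point3 x y z].
Proof.
rewrite -[LHS]/((horner_eval z \o map_poly (eval_xy x y)) (poly_z F)).
have evC q : (map_poly (eval_xy x y) q%:P).[z] = q.[x%:P].[y].
  by rewrite map_polyC hornerC.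
apply: rmorph_mmap => [c|l].
  by rewrite -[LHS]/(map_poly (eval_xy x y) c%:P%:P%:P).[z] evC !hornerC.
case: l => [[|[|[|l]]] ltl] //.
- by rewrite -[LHS]/(map_poly (eval_xy x y) 'X%:P).[z] evC hornerX hornerC.
- by rewrite -[LHS]/(map_poly (eval_xy x y) 'X%:P%:P).[z] evC hornerC hornerX.
- by rewrite -[LHS]/(map_poly (eval_xy x y) 'X).[z] map_polyX hornerX.
Qed.

(** By homogeneity only the pure power of the third variable reaches degree d in it. If F(0,0,1) is
    nonzero, the leading coefficient is thus a nonzero constant and resultants commute with
    specialization. *)
Lemma poly_z_coef d F i : F \is d.-homog -> (d <= i)%N ->
  (poly_z F)`_i = if i == d then (F.@[point3 0 0 1])%:P%:P else 0.
Proof.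
move=> /dhomogP homF lei; rewrite /poly_z /mmap coef_sum mevalE.
rewrite [in RHS]big_seq big_seq.
transitivity (\sum_(m <- msupp F | m \in msupp F)
   (if i == d then (F@_m * \prod_l point3 0 0 1 l ^+ m l)%:P%:P else 0) : {poly {poly C}}).
  apply: eq_bigr => m ms; have mdeg_m : mdeg m = d := homF m ms.
  rewrite mdegE in mdeg_m; rewrite /mmap1.
  rewrite !big_ord_recl !big_ord0 /= in mdeg_m *.
  rewrite !mulr1 !addn0 in mdeg_m *.
  rewrite -!polyC_exp !mulrA -!polyCM coefCM coefXn.
  rewrite /point3 /= expr1n mulr1 -[_ * _ * 0 ^+ _]mulrA -exprD expr0n.
  move: mdeg_m; set u := m _; set v := m _; set w := m _ => mdeg_m.
  case: (eqVneq i d) => [->|nid]; last first.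
    by rewrite (_ : (i == w) = false) ?mulr0 //; apply/eqP; lia.
  have [u0|u0] := eqVneq (u + v)%N 0%N.
    have [-> -> ->] : [/\ u = 0, v = 0 & d = w]%N by split; lia.
    by rewrite !expr0 eqxx !mulr1.
  by rewrite (_ : (d == w) = false) ?mulr0 ?polyC0 //; apply/eqP; lia.
case: eqP => _; last by rewrite big1.
by rewrite !raddf_sum.
Qed.

Lemma common_root (p q : {poly C}) :
  resultant p q = 0 -> exists z, p.[z] = 0 /\ q.[z] = 0.
Proof.
move/eqP; rewrite resultant_eq0 => sz.
have /closed_rootP[z] : size (gcdp p q) != 1%N by rewrite neq_ltn sz orbT.
by rewrite root_gcd => /andP[/rootP rp /rootP rq]; exists z.
Qed.

Lemma common_root_resultant (p q : {poly C}) z :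
  p != 0 -> p.[z] = 0 -> q.[z] = 0 -> resultant p q = 0.
Proof.
move=> p0 /rootP rp /rootP rq; apply/eqP; rewrite resultant_eq0.
have : root (gcdp p q) z by rewrite root_gcd rp rq.
by move/root_size_gt1; apply; rewrite gcdp_eq0 negb_and p0.
Qed.

(** The resultant in the third variable vanishes at the origin of the (x, y)-plane, hence also at
    some other point, over which a common root z exists. *)
Lemma common_zero_monic d (F G : {mpoly C[3]}) :
  (0 < d)%N -> F \is d.-homog -> G \is d.-homog ->
  F.@[point3 0 0 1] != 0 -> G.@[point3 0 0 1] != 0 ->
  exists v, [/\ exists l, v l != 0, F.@[v] = 0 & G.@[v] = 0].
Proof.
move=> d_gt0 homF homG F1 G1.
have lead_z H : H \is d.-homog -> H.@[point3 0 0 1] != 0 ->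
    lead_coef (poly_z H) = (H.@[point3 0 0 1])%:P%:P.
  move=> homH H1.
  have coefd : (poly_z H)`_d = (H.@[point3 0 0 1])%:P%:P.
    by rewrite (poly_z_coef homH) // eqxx.
  suff szH : size (poly_z H) = d.+1 by rewrite lead_coefE szH coefd.
  apply/eqP; rewrite eqn_leq; apply/andP; split.
    by apply/leq_sizeP => i lti; rewrite (poly_z_coef homH) ?(gtn_eqF lti) // ltnW.
  rewrite ltnNge; apply/negP => /leq_sizeP/(_ d (leqnn _))/eqP.
  by rewrite coefd !polyC_eq0; apply/negP.
have eval_lead x y H : H \is d.-homog -> H.@[point3 0 0 1] != 0 ->
    eval_xy x y (lead_coef (poly_z H)) != 0.
  by move=> homH H1; rewrite lead_z //= /horner_eval !hornerC.
pose N := resultant (poly_z F) (poly_z G).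
have NE x y : eval_xy x y N =
    resultant (map_poly (eval_xy x y) (poly_z F)) (map_poly (eval_xy x y) (poly_z G)).
  by apply: map_resultant; apply: eval_lead.
have zero_of_N x y : eval_xy x y N = 0 ->
    exists z, F.@[point3 x y z] = 0 /\ G.@[point3 x y z] = 0.
  move=> N0; have [z [Fz Gz]] := common_root (etrans (esym (NE x y)) N0).
  by exists z; rewrite -!poly_z_eval.
have N00 : eval_xy 0 0 N = 0.
  have root0 H : H \is d.-homog -> (map_poly (eval_xy 0 0) (poly_z H)).[0] = 0.
    move=> homH; rewrite poly_z_eval.
    rewrite (meval_dhomog_scale (c := 0) (w := fun=> 0) homH); last first.
      by case=> [[|[|[|l]]] ltl]; rewrite /point3 /= ?mul0r.
    by rewrite expr0n (gtn_eqF d_gt0) mul0r.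
  rewrite NE (common_root_resultant _ (root0 F homF) (root0 G homG)) //.
  by rewrite -lead_coef_eq0 lead_coef_map_eq eval_lead.
have [x [y [xy Nxy]]] : exists x y, (x != 0) || (y != 0) /\ eval_xy x y N = 0.
  (* If [N] is constant in x, its zero (0, 0) moves to (1, 0). Otherwise some nonzero y keeps the
     leading coefficient nonzero, and one solves for x. *)
  have [sz1|sz1] := leqP (size N) 1.
    exists 1, 0; split; first by rewrite oner_neq0.
    by move: N00; rewrite (size1_polyC sz1) /= /horner_eval !hornerC.
  have lN : lead_coef N * 'X != 0.
    by rewrite mulf_neq0 ?polyX_eq0 // lead_coef_eq0 -size_poly_gt0 ltnW.
  have [y] := closed_nonrootP _ lN; rewrite rootM rootX negb_or => /andP[ly y0].
  have : size (map_poly (horner_eval y) N) != 1%N.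
    by rewrite size_map_poly_id0 ?neq_ltn ?sz1 ?orbT // /horner_eval -/(root _ _).
  move=> /closed_rootP[x /rootP rx]; exists x, y; rewrite y0 orbT; split=> //.
  by rewrite -rx /= -{2}[x](hornerC x y) -[_.[y]]/(horner_eval y _) horner_map.
have [z [Fz Gz]] := zero_of_N _ _ Nxy.
exists (point3 x y z); split=> //.
by case/orP: xy => h; [exists ord0 | exists (lift ord0 ord0)].
Qed.

(** Replacing G by F + G keeps the common zeros and makes the value at (0,0,1) nonzero when only F
    is nonzero there; if both vanish there, that point serves. *)
Lemma common_zero d (F G : {mpoly C[3]}) :
  (0 < d)%N -> F \is d.-homog -> G \is d.-homog ->
  exists v, [/\ exists l, v l != 0, F.@[v] = 0 & G.@[v] = 0].
Proof.
move=> d_gt0.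
have key F' G' : F' \is d.-homog -> G' \is d.-homog -> F'.@[point3 0 0 1] != 0 ->
    exists v, [/\ exists l, v l != 0, F'.@[v] = 0 & G'.@[v] = 0].
  move=> homF homG F1; have [G1|G1] := eqVneq G'.@[point3 0 0 1] 0; last first.
    exact: common_zero_monic homF homG F1 G1.
  have [|v [v0 Fv]] := common_zero_monic d_gt0 homF (dhomogD homF homG) F1.
    by rewrite mevalD G1 addr0.
  by rewrite mevalD Fv add0r => Gv; exists v.
move=> homF homG; have [F1|F1] := eqVneq F.@[point3 0 0 1] 0; last exact: key.
have [G1|G1] := eqVneq G.@[point3 0 0 1] 0; last first.
  by have [v [v0 Gv Fv]] := key G F homG homF G1; exists v.
exists (point3 0 0 1); split=> //; exists ord_max; exact: oner_neq0.
Qed.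

End PlaneCurvesMeet.

(** * Singular points of an arrangement and the conclusion *)

Section Arrangement.
Variables (R : realType) (d k m : nat) (F : 'I_k -> {mpoly (complex R)[3]})
  (pts : 'I_m -> ('I_3 -> complex R)).
Hypotheses (d_gt0 : (0 < d)%N) (arrF : d_arrangement F d)
  (enum_pts : sing_enumeration F pts).

(** If [F i] vanishes at the point, the derivative of the union there is that of [F i] times the
    product of the others; smoothness forces another factor to vanish. *)
Lemma sing_pt_two_curves p :
  exists i j, [/\ i != j, (F i).@[pts p] == 0 & (F j).@[pts p] == 0].
Proof.
have [smF _] := arrF; have [/(_ p)[v0 [Uv dUv]] _] := enum_pts.
move/eqP: Uv; rewrite /union_poly rmorph_prod => /prodf_eq0[i _ /eqP Fi].
have [_ [_ /(_ _ v0 Fi)[l dFi]]] := smF i.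
have := dUv l; rewrite /union_poly (bigD1 i) //= mderivM mevalD !mevalM Fi mul0r addr0.
move=> /eqP; rewrite mulf_eq0 (negPf dFi) rmorph_prod => /prodf_eq0[j nji Fj].
by exists i, j; rewrite eq_sym nji Fj; split=> //; apply/eqP.
Qed.

(** A common zero is singular on the union by the product rule, so it is proportional to a listed
    point; homogeneity transfers the vanishing. *)
Lemma curves_meet i j : i != j ->
  exists p, ((F i).@[pts p] == 0) && ((F j).@[pts p] == 0).
Proof.
move=> nij; have [smF _] := arrF; have [_ [_ singE]] := enum_pts.
have homF t : F t \is d.-homog by have [_ []] := smF t.
have [v [v0 Fi Fj]] := common_zero d_gt0 (homF i) (homF j).
have sing_v : sing_pt F v.
  split=> //; rewrite /union_poly (bigD1 i) //= (bigD1 j) 1?eq_sym //=.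
  split=> [|l]; first by rewrite mevalM Fi mul0r.
  by rewrite mderivM mevalD !mevalM Fi Fj !mul0r mulr0 addr0.
have [p [c [c0 vE]]] := singE v sing_v; exists p.
have on_pts t : (F t).@[v] = 0 -> (F t).@[pts p] == 0.
  move=> /eqP; rewrite (meval_dhomog_scale (homF t) vE) mulf_eq0.
  by rewrite expf_eq0 (negPf c0) andbF.
by rewrite !on_pts.
Qed.

End Arrangement.

Theorem theorem4p8 (R : realType) (d k : nat) (F : 'I_k -> {mpoly (complex R)[3]})
    (m : nat) (pts : 'I_m -> ('I_3 -> complex R)) (K : fieldType) :
  (3 <= k)%N -> (1 <= d)%N ->
  d_arrangement F d ->
  sing_enumeration F pts ->
  ~ CohenMacaulay_quot (binomial_edge_gens K (levi_rel F pts)).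
Proof.
move=> k_ge3 d_gt0 arrF enum_pts.
(* [levi_rel] is convertible to [incidence_rel] for this incidence. *)
apply: (@incidence_rel_not_CM m k (fun p j => (F j).@[pts p] == 0) K k_ge3).
- exact: sing_pt_two_curves arrF enum_pts.
- exact: curves_meet d_gt0 arrF enum_pts.
Qed.
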